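(* For the system $$\dot R_i=K_i-f_i(p(q))R_i-\alpha(q)R_i\quad(i=1,\dots,n),\qquad\dot q=\alpha(q)\sum_{i=1}^nR_i-\mu(q),$$ with right-hand side denoted $F(R,q)$, consider the fixed point $(R^u,q^u)$, characterized by $p'(q^u)<0$. The Jacobian $DF(R^u,q^u)\in\mathbb{R}^{(n+1)\times(n+1)}$ has the following properties: (i) $DF(R^u,q^u)$ has at least $n-1$ real, negative eigenvalues (counted with multiplicity); (ii) $DF(R^u,q^u)$ has a positive eigenvalue. In particular, $(R^u,q^u)$ is an exponentially unstable fixed point.
   Context: Write $\mathbb{R}_+=[0,\infty)$; the system is considered on $\mathbb{R}_+^{n+1}$. Let $n\ge1$ be an integer and fix constants $K_1,\dots,K_n,\mu^*,q_c,\beta,q_m>0$. Price function: $p(q)=\beta q$ for $0\le q\le q_m$, $p(q)=\beta(2q_m-q)$ for $q_m\le q\le2q_m$, $p(q)=0$ for $q>2q_m$. Service rate: $\mu(q)=\frac{\mu^*}{q_c}q$ for $0\le q\le q_c$, $\mu(q)=\mu^*$ for $q\ge q_c$. Admission rate: $\alpha:\mathbb{R}_+\to\mathbb{R}_+$ is continuously differentiable and nonincreasing with $\alpha(0)>0$. Price responses: $f_i:\mathbb{R}_+\to\mathbb{R}_+$, $i=1,\dots,n$, are nondecreasing and continuously differentiable, and at least one of them has strictly positive derivative (some may be identically $0$). Let $g(q)=\sum_{i=1}^n\frac{K_i}{f_i(p(q))+\alpha(q)}-\frac{\mu(q)}{\alpha(q)}$ on $\{q\ge0:\alpha(q)>0\}$.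 Assume $g$ has exactly two zeros $q^s,q^u$, with $0<q^s<q_m<q^u<2q_m$, that $g$ changes sign at each of them, and that $g$ is differentiable at $q^u$ with $$g'(q^u)=-\sum_{i=1}^n\frac{K_i((f_i\circ p)'(q^u)+\alpha'(q^u))}{(f_i(p(q^u))+\alpha(q^u))^2}-\frac{\mu'(q^u)\alpha(q^u)-\mu(q^u)\alpha'(q^u)}{\alpha(q^u)^2}>0 .$$ Each zero $q^*\in\{q^s,q^u\}$ of $g$ gives the fixed point $(R^*,q^* )$ with $R_i^*=\frac{K_i}{f_i(p(q^* ))+\alpha(q^* )}$; $(R^u,q^u)$ is the one for $q^u$. A fixed point is called exponentially unstable if it is unstable and its linearization has an eigenvalue with positive real part. *)

(* Defs.v *)
From HB Require Import structures.
From mathcomp Require Import all_boot all_order all_algebra.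
From mathcomp Require Import all_classical all_reals all_analysis.
From mathcomp Require Import complex.

Set Implicit Arguments.
Unset Strict Implicit.
Unset Printing Implicit Defensive.

Import Order.TTheory GRing.Theory Num.Theory.
Import numFieldNormedType.Exports.

Local Open Scope classical_set_scope.
Local Open Scope ring_scope.

(* Derivative of h at x relative to D, so that it is one-sided at an endpoint
   of D. *)
Definition has_derivative_within (R : realType) (V : normedModType R)
    (D : set R) (h : R -> V) (x : R) (l : V) : Prop :=
  (fun y => (y - x)^-1 *: (h y - h x)) @ within D x^' --> l.

(* Functions on [0, +oo[ are total functions on R of which only the values on
   [0, +oo[ matter.  [C1_Rplus h dh] says that h is continuously differentiable
   on [0, +oo[ with derivative dh (one-sided at 0). *)
Definition C1_Rplus (R : realType) (h dh : R -> R) : Prop :=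
  (forall x, 0 <= x -> has_derivative_within `[0, +oo[ h x (dh x)) /\
  {within `[0, +oo[, continuous dh}.

Definition price (R : realType) (beta qm q : R) : R :=
  if q <= qm then beta * q
  else if q <= 2 * qm then beta * (2 * qm - q)
  else 0.

Definition service (R : realType) (mustar qc q : R) : R :=
  if q <= qc then mustar / qc * q else mustar.

Definition gfun (R : realType) (n : nat) (K : 'I_n -> R)
    (f : 'I_n -> R -> R) (alpha p mu : R -> R) (q : R) : R :=
  \sum_(i < n) K i / (f i (p q) + alpha q) - mu q / alpha q.

Definition dgfun (R : realType) (n : nat) (K : 'I_n -> R)
    (f : 'I_n -> R -> R) (alpha p mu : R -> R) (q : R) : R :=
  - (\sum_(i < n) K i * (derive1 (f i \o p) q + derive1 alpha q)
                  / (f i (p q) + alpha q) ^+ 2)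
  - (derive1 mu q * alpha q - mu q * derive1 alpha q) / alpha q ^+ 2.

Definition changes_sign (R : realType) (h : R -> R) (z : R) : Prop :=
  ((\forall x \near z^'-, h x < 0) /\ (\forall x \near z^'+, 0 < h x)) \/
  ((\forall x \near z^'-, 0 < h x) /\ (\forall x \near z^'+, h x < 0)).

(* The point (r, q) is the row vector (r_0, ..., r_(n-1), q). *)
Definition state (R : realType) (n : nat) (r : 'I_n -> R) (q : R) :
    'rV[R]_n.+1 :=
  \row_(j < n.+1) (if unlift ord_max j is Some i then r i else q).

Definition vfield (R : realType) (n : nat) (K : 'I_n -> R)
    (f : 'I_n -> R -> R) (alpha p mu : R -> R) (x : 'rV[R]_n.+1) :
    'rV[R]_n.+1 :=
  let r := fun i : 'I_n => x ord0 (lift ord_max i) in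
  let q := x ord0 ord_max in
  state (fun i => K i - f i (p q) * r i - alpha q * r i)
        (alpha q * (\sum_(i < n) r i) - mu q).

Definition orthant (R : realType) (m : nat) : set 'rV[R]_m :=
  [set x | forall j, 0 <= x ord0 j].

Definition ode_solution (R : realType) (m : nat) (D : set 'rV[R]_m)
    (F : 'rV[R]_m -> 'rV[R]_m) (T : R) (x : R -> 'rV[R]_m) : Prop :=
  forall t, 0 <= t <= T ->
    D (x t) /\ has_derivative_within `[0, T] x t (F (x t)).

(* Lyapunov stability of xe for x' = F x on the state space D.  Solutions on
   every compact interval [0, T] are considered; this covers solutions on
   [0, +oo[, since they restrict to each [0, T]. *)
Definition stable (R : realType) (m : nat) (D : set 'rV[R]_m)
    (F : 'rV[R]_m -> 'rV[R]_m) (xe : 'rV[R]_m) : Prop :=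
  forall e : R, 0 < e -> exists2 d : R, 0 < d &
    forall (T : R) (x : R -> 'rV[R]_m), ode_solution D F T x ->
      `|x 0 - xe| < d -> forall t, 0 <= t <= T -> `|x t - xe| < e.

(* [jacobian F xe] acts on row vectors, 'd F xe v = v *m jacobian F xe, so it is
   the transpose of the usual Jacobian matrix; [eigenvalue] also refers to
   row vectors, so that its eigenvalues are those of the linearization. *)
Definition exponentially_unstable_fixed_point (R : realType) (m : nat)
    (D : set 'rV[R]_m) (F : 'rV[R]_m -> 'rV[R]_m) (xe : 'rV[R]_m) : Prop :=
  [/\ D xe, F xe = 0, ~ stable D F xe, differentiable F xe &
    exists2 z : complex.complex R, 0 < complex.Re z &
      eigenvalue (map_mx (complex.real_complex R) (jacobian F xe)) z].

(* Main.v *)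
Require Import Defs.
From HB Require Import structures.
From mathcomp Require Import all_boot all_order all_algebra.
From mathcomp Require Import all_classical all_reals all_analysis.
From mathcomp Require Import polyrcf complex ring lra.

Set Implicit Arguments.
Unset Strict Implicit.
Unset Printing Implicit Defensive.

Import Order.TTheory GRing.Theory Num.Theory.
Import numFieldNormedType.Exports.

Local Open Scope classical_set_scope.
Local Open Scope ring_scope.

(* Near (R^u, q^u) the price is decreasing, so each c_i(q) = f_i(p(q)) + alpha(q)
   is nonincreasing and the system is cooperative: the Jacobian is a diagonal
   matrix -diag(c_i) bordered by one row and one column, with w_i >= 0 the product
   of the two border entries at i, and with corner d.  Its characteristic
   polynomial is P = (X - d) prod_i (X + c_i) - sum_i w_i prod_(j != i) (X + c_j).
   All roots of P are real, and P(0) has the sign of -g'(q^u) < 0, which gives a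
   root a > 0; the cofactor of X - a is positive on [0, +oo[, so all other roots
   are negative.

   For instability, a has a left eigenvector w (for the usual Jacobian) with
   positive entries.  Solutions started above the fixed point stay above it, and
   along them z = w . (x - xe) satisfies z' >= (a / 2) z as long as x is close to
   xe; z being comparable to the norm there, they leave a fixed neighbourhood.
   They exist by Picard iteration for a vector field clamped to a box. *)

(** * Arrow matrices *)

(** Formally [\prod_i ('X + c i)] times ['X - d - \sum_i w i / ('X + c i)], cleared of denominators
    so that it makes sense over any commutative ring. *)
Definition arrow_poly (T : comNzRingType) (n : nat) (d : T) (c w : 'I_n -> T) :
    {poly T} :=
  ('X - d%:P) * \prod_(i < n) ('X + (c i)%:P) -
  \sum_(i < n) (w i)%:P * \prod_(j < n | j != i) ('X + (c j)%:P).

(** Right multiplication by an upper triangular [U] of determinant [\prod_i c i] turns [M] into a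
    lower triangular matrix with diagonal [c i] and last corner [e]. The factor [\prod_i c i] is
    then cancelled, which is legitimate in an integral domain, in particular for polynomial
    entries. *)
Lemma det_arrow (T : idomainType) (n : nat) (c : 'I_n -> T) (M : 'M[T]_n.+1) :
    (forall i, c i != 0) ->
    (forall i j, M (lift ord_max i) (lift ord_max j) = c i *+ (i == j)) ->
  \det M = M ord_max ord_max * \prod_i c i -
    \sum_i M ord_max (lift ord_max i) * M (lift ord_max i) ord_max *
           \prod_(j | j != i) c j.
Proof.
move=> c0 Mdiag; set e := RHS.
have max_ltF (j : 'I_n.+1) : ((@ord_max n : 'I_n.+1) < j)%N = false.
  by rewrite ltnNge -ltnS ltn_ord.
have ltS (i j : 'I_n) : (lift ord_max i < lift ord_max j)%N -> (i == j) = false.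
  by rewrite !lift_max => /ltn_eqF.
(* Column operations clearing the last column above the diagonal, denominators
   being cleared by the factor [\prod_i c i]. *)
pose U : 'M[T]_n.+1 := \matrix_(i, j)
  if j == ord_max then
    if unlift ord_max i is Some k then - (M i ord_max * \prod_(l | l != k) c l)
    else \prod_l c l
  else (i == j)%:R.
have detU : \det U = \prod_i c i.
  rewrite -det_tr det_trig; last first.
    apply/is_trig_mxP => i j ltij; rewrite !mxE.
    case: (unliftP ord_max i) ltij => [i' ->|->]; last by rewrite max_ltF.
    rewrite eq_sym (negPf (neq_lift _ _)).
    by case: eqP => // ->; rewrite ltnn.
  rewrite (bigD1_ord ord_max)//= !mxE eqxx unlift_none [X in _ * X]big1 ?mulr1//= => i _.
  by rewrite !mxE eq_sym (negPf (neq_lift _ _)) eqxx.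
have MUE i j : (M *m U) i (lift ord_max j) = M i (lift ord_max j).
  rewrite mxE (bigD1 (lift ord_max j))//= big1 ?addr0 => [|k kj].
    by rewrite !mxE eq_sym (negPf (neq_lift _ _)) eqxx mulr1.
  by rewrite !mxE eq_sym (negPf (neq_lift _ _)) (negPf kj) mulr0.
have MUi i : (M *m U) (lift ord_max i) ord_max = 0.
  rewrite mxE (bigD1_ord ord_max)//= !mxE eqxx unlift_none.
  rewrite [X in _ + X](bigD1 i)//= [X in _ + (_ + X)]big1 ?addr0 => [|k ki]; last first.
    by rewrite Mdiag eq_sym (negPf ki) mulr0n mul0r.
  rewrite !mxE eqxx liftK Mdiag eqxx mulr1n [\prod_(l < n) c l](bigD1 i)//=.
  ring.
have MUm : (M *m U) ord_max ord_max = e.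
  rewrite mxE (bigD1_ord ord_max)//= !mxE eqxx unlift_none; congr (_ + _).
  rewrite -sumrN; apply: eq_bigr => i _.
  by rewrite !mxE eqxx liftK mulrN mulrA.
have := det_mulmx M U.
rewrite detU det_trig; last first.
  apply/is_trig_mxP => i j.
  case: (unliftP ord_max j) => [j' ->|->].
    rewrite MUE; case: (unliftP ord_max i) => [i' ->|->] ltij.
      by rewrite Mdiag ltS.
    by rewrite max_ltF in ltij.
  by case: (unliftP ord_max i) => [i' ->|->]; rewrite ?MUi // ltnn.
rewrite (bigD1_ord ord_max)//= MUm => eqM.
apply/esym/(mulIf (_ : \prod_i c i != 0)); first by apply/prodf_neq0.
rewrite -eqM; congr (_ * _); apply: eq_bigr => i _.
by rewrite MUE Mdiag eqxx.
Qed.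

(** [det_arrow] over [{poly T}], with ['X + (c i)%:P] on the diagonal. Both border entries change
    sign in the characteristic matrix, so their product does not. *)
Lemma char_poly_arrow (T : idomainType) (n : nat) (c : 'I_n -> T)
    (M : 'M[T]_n.+1) :
    (forall i j, M (lift ord_max i) (lift ord_max j) = - c i *+ (i == j)) ->
  char_poly M = arrow_poly (M ord_max ord_max) c
    (fun i => M ord_max (lift ord_max i) * M (lift ord_max i) ord_max).
Proof.
move=> Mdiag; rewrite /char_poly (@det_arrow _ _ (fun i => 'X + (c i)%:P)).
- rewrite !mxE eqxx mulr1n; congr (_ - _); apply: eq_bigr => i _.
  rewrite !mxE (negPf (neq_lift _ _)) eq_sym (negPf (neq_lift _ _)).
  by rewrite !sub0r mulrNN -polyCM.
- by move=> i; rewrite -size_poly_gt0 size_XaddC.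
move=> i j; rewrite !mxE Mdiag (inj_eq (@lift_inj _ _)).
by case: eqP => _ //; rewrite ?subrr // mulr1n mulr1n polyCN opprK.
Qed.

(** * Roots of the characteristic polynomial *)

Section real_arrow.
Variables (R : rcfType) (n : nat) (d : R) (c w : 'I_n -> R).
Hypothesis c_gt0 : forall i, 0 < c i.
Hypothesis w_ge0 : forall i, 0 <= w i.
Let P := arrow_poly d c w.

(** For [x >= 0] no [x + c i] vanishes, so the nonnegative roots of [P] are the zeros of the last
    factor. *)
Lemma arrow_poly_fracE (x : R) : 0 <= x ->
  P.[x] = (\prod_i (x + c i)) * (x - d - \sum_i w i / (x + c i)).
Proof.
move=> x0; rewrite /P /arrow_poly !hornerE horner_prod.
under eq_bigr do rewrite !hornerE.
rewrite [RHS]mulrBr; congr (_ - _); first by rewrite mulrC.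
rewrite horner_sum mulr_sumr; apply: eq_bigr => i _.
rewrite !hornerE horner_prod [in RHS](bigD1 i)//=.
under eq_bigr do rewrite !hornerE.
by field; rewrite gt_eqF // ltr_wpDl.
Qed.

(** [P.[0]] is [- (d + \sum_i w i / c i)] times a positive product, and a monic polynomial is
    eventually positive, so the intermediate value theorem applies. *)
Lemma arrow_poly_pos_root : P \is monic -> 0 < d + \sum_i w i / c i ->
  exists2 a, 0 < a & root P a.
Proof.
move=> Pmonic dgt0.
have P0 : P.[0] < 0.
  rewrite arrow_poly_fracE // pmulr_rlt0; last first.
    by apply: prodr_gt0 => i _; rewrite add0r.
  under eq_bigr do rewrite add0r.
  by rewrite sub0r -opprD oppr_lt0.
have lP : 0 < lead_coef P by rewrite (monicP Pmonic).
have [b bP] := poly_pinfty_gt_lc lP.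
(* [b] may be negative; the maximum keeps the interval to the right of 0. *)
have Pb : 0 < P.[Num.max b 0].
  rewrite (lt_le_trans _ (bP _ _)) ?(monicP Pmonic) ?ltr01//.
  by rewrite le_max lexx.
have le0b : 0 <= Num.max b 0 by rewrite le_max lexx orbT.
have P0b : P.[0] * P.[Num.max b 0] < 0 by rewrite nmulr_rlt0.
have [a] := poly_ivtoo le0b P0b.
by rewrite in_itv /= => /andP[a0 _] ra; exists a.
Qed.

(* If [z] is a root then [z - d = \sum_i w i / (z + c i)], and the imaginary
   parts of the two sides have opposite signs unless [z] is real. *)
Lemma arrow_poly_root_real (z : R[i]) :
  root (map_poly (real_complex R) P) z -> complex.Im z = 0.
Proof.
case: z => x y /= rz; apply/eqP/negPn/negP => y0.
pose z : R[i] := Complex x y.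
pose C (a : R) := real_complex R a.
have zc i : z + C (c i) != 0 by rewrite eq_complex /= addr0 negb_and y0 orbT.
pose N i := (x + c i) ^+ 2 + y ^+ 2.
have N0 i : 0 < N i by rewrite ltr_wpDl ?sqr_ge0 // exprn_even_gt0.
(* Since [y != 0], no [z + C (c i)] vanishes and the root equation can be divided by their
   product. *)
have : z - C d = \sum_i C (w i) / (z + C (c i)).
  apply: (@mulIf _ (\prod_i (z + C (c i)))); first by apply/prodf_neq0.
  move/rootP: rz; rewrite /P /arrow_poly rmorphB rmorphM /= rmorphB /=.
  rewrite map_polyX map_polyC /= rmorph_prod /= rmorph_sum /= !hornerE.
  rewrite horner_prod horner_sum => /subr0_eq.
  under eq_bigr do rewrite rmorphD /= map_polyX map_polyC !hornerE.
  move=> ->; rewrite mulr_suml; apply: eq_bigr => i _.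
  rewrite rmorphM rmorph_prod /= map_polyC !hornerE horner_prod [in RHS](bigD1 i)//=.
  under eq_bigr do rewrite rmorphD /= map_polyX map_polyC !hornerE.
  by field; exact: zc.
move=> /(congr1 (@complex.Im R)).
have -> : complex.Im (z - C d) = y by rewrite /= oppr0 addr0.
have -> : complex.Im (\sum_i C (w i) / (z + C (c i))) = - y * \sum_i w i / N i.
  rewrite mulr_sumr (big_morph (@complex.Im R) (id1 := 0) (op1 := +%R)) //.
    apply: eq_bigr => i _ /=.
    rewrite !addr0 -/(N i); ring.
  by move=> [? ?] [? ?].
have S0 : 0 <= \sum_i w i / N i.
  by apply: sumr_ge0 => i _; rewrite divr_ge0 // ltW.
(* Comparing imaginary parts gives [y * (1 + \sum_i w i / N i) = 0], whose second factor is at least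
   1. *)
move=> /eqP; rewrite mulNr -addr_eq0 -[X in X + _]mulr1 -mulrDr mulf_eq0.
by rewrite (negPf y0) /= gt_eqF // ltr_pwDl.
Qed.

End real_arrow.

Section real_arrow_split.
Variables (R : rcfType) (n : nat) (d : R) (c w : 'I_n -> R).
Hypothesis c_gt0 : forall i, 0 < c i.
Hypothesis w_ge0 : forall i, 0 <= w i.
Let P := arrow_poly d c w.

(* Synthetic division by ['X - a] leaves a polynomial that is positive on
   [0, +oo[, hence has only negative roots. *)
Lemma arrow_poly_split (a : R) : P \is monic -> size P = n.+2 ->
    0 < a -> root P a ->
  exists s : seq R, [/\ size s = n, all (fun x => x < 0) s &
    P = ('X - a%:P) * \prod_(x <- s) ('X - x%:P)].
Proof.
move=> Pmonic sizeP a0 ra; have ac i : 0 < a + c i by rewrite addr_gt0.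
have /factor_theorem[S PE] := ra; rewrite mulrC in PE.
have Smonic : S \is monic by move: Pmonic; rewrite PE monicMl ?monicXsubC.
have sizeS : size S = n.+1.
  by move: sizeP; rewrite PE size_Mmonic ?monicXsubC ?polyXsubC_eq0 // size_XsubC /= => -[].
(* The quotient in closed form: [a - d = \sum_i w i / (a + c i)] because [a] is a root, and [w i /
   (a + c i) * ('X + c i) - w i = w i / (a + c i) * ('X - a)]. *)
pose B := \prod_(i < n) ('X + (c i)%:P) +
  \sum_(i < n) (w i / (a + c i))%:P * \prod_(j < n | j != i) ('X + (c j)%:P).
have BE : P = ('X - a%:P) * B.
  have ad : a - d = \sum_i w i / (a + c i).
    move/rootP: ra; rewrite arrow_poly_fracE ?ltW // => /eqP.
    rewrite mulf_eq0 => /orP[|/eqP/subr0_eq //].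
    by move=> /prodf_eq0[i _]; rewrite gt_eqF.
  rewrite /P /arrow_poly /B mulrDr mulr_sumr.
  have -> : 'X - d%:P = 'X - a%:P + \sum_i (w i / (a + c i))%:P :> {poly R}.
    by rewrite -rmorph_sum /= -ad polyCB; ring.
  rewrite mulrDl -addrA; congr (_ + _).
  rewrite mulr_suml -sumrB; apply: eq_bigr => i _.
  have -> : (w i)%:P = (w i / (a + c i))%:P * (a%:P + (c i)%:P).
    by rewrite -polyCD -polyCM divfK ?gt_eqF.
  rewrite [X in _ * X - _](bigD1 i)//=; ring.
have SB : S = B.
  by apply/(@mulfI _ ('X - a%:P)); rewrite ?polyXsubC_eq0 // -PE -BE.
have Sneg x : root S x -> x < 0.
  apply: contraTT; rewrite -leNgt => x0; rewrite /root SB gt_eqF //.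
  rewrite /B !hornerE horner_prod horner_sum ltr_pwDl //.
    by apply: prodr_gt0 => i _; rewrite !hornerE ltr_wpDl.
  apply: sumr_ge0 => i _; rewrite !hornerE horner_prod mulr_ge0 //.
    by rewrite divr_ge0 // ltW.
  by apply: prodr_ge0 => j _; rewrite !hornerE addr_ge0 // ltW.
(* [S] splits over [R[i]]; its roots are roots of [P], hence real, so the splitting descends to
   [R]. *)
have [r rE] := closed_field_poly_normal (map_poly (real_complex R) S).
have lS : lead_coef (map_poly (real_complex R) S) = 1.
  by rewrite lead_coef_map (monicP Smonic).
rewrite lS scale1r in rE.
have rroot z : z \in r -> root (map_poly (real_complex R) S) z.
  by rewrite rE root_prod_XsubC.
have rreal z : z \in r -> z = real_complex R (complex.Re z).
  move=> /rroot rz; have : complex.Im z = 0.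
    apply: (arrow_poly_root_real (d := d) (c := c) w_ge0).
    by rewrite -/P PE rmorphM rootM rz orbT.
  by case: z {rz} => x y /= ->.
have SE : S = \prod_(x <- [seq complex.Re z | z <- r]) ('X - x%:P).
  apply: (map_poly_inj (real_complex R)); rewrite rE rmorph_prod big_map.
  apply: eq_big_seq => z /rreal {1}->.
  by rewrite rmorphB /= map_polyX map_polyC.
exists [seq complex.Re z | z <- r]; split.
- by move: sizeS; rewrite {1}SE size_prod_XsubC => -[].
- by apply/allP => x xr; apply: Sneg; rewrite SE root_prod_XsubC.
- by rewrite -SE.
Qed.

End real_arrow_split.

(** The equation satisfied by [a] is returned along with the factorization: it is the last row of
    the eigenvector equation in the instability argument. *)
Lemma arrow_spectrum (R : rcfType) (n : nat) (c : 'I_n -> R)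
    (M : 'M[R]_n.+1) :
    let w i := M ord_max (lift ord_max i) * M (lift ord_max i) ord_max in
    (forall i, 0 < c i) -> (forall i, 0 <= w i) ->
    (forall i j, M (lift ord_max i) (lift ord_max j) = - c i *+ (i == j)) ->
    0 < M ord_max ord_max + \sum_i w i / c i ->
  exists a (s : seq R), [/\ 0 < a,
    a = M ord_max ord_max + \sum_i w i / (a + c i), size s = n,
    all (fun x => x < 0) s &
    char_poly M = ('X - a%:P) * \prod_(x <- s) ('X - x%:P)].
Proof.
move=> w c0 w0 Mdiag d0; have PE := char_poly_arrow Mdiag; rewrite -/w in PE.
have Pmonic := char_poly_monic M; have sizeP := size_char_poly M.
rewrite PE in Pmonic sizeP.
have [a a0 ra] := arrow_poly_pos_root c0 Pmonic d0.
have [s [sn sneg sE]] := arrow_poly_split c0 w0 Pmonic sizeP a0 ra.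
exists a, s; rewrite PE; split=> //.
move/rootP: ra; rewrite arrow_poly_fracE ?ltW // => /eqP; rewrite mulf_eq0.
case/orP => [/prodf_eq0[i _]|]; first by rewrite gt_eqF // addr_gt0.
by rewrite subr_eq0 subr_eq addrC => /eqP.
Qed.

(** * Calculus *)

Lemma ge0_derive_le (R : realType) (f df : R -> R) (a b : R) : a <= b ->
    (forall x, a <= x <= b -> is_derive x 1 f (df x)) ->
    (forall x, a <= x <= b -> 0 <= df x) ->
  f a <= f b.
Proof.
move=> ab fdf df0.
have [||c cab fE] := @MVT_segment _ f df a b ab.
  by move=> x /[!in_itv]/= /andP[/ltW ax /ltW xb]; apply: fdf; rewrite ax.
  apply: derivable_within_continuous => x /[!in_itv]/= xab.
  by have := fdf _ xab; case.
by rewrite -subr_ge0 fE mulr_ge0 ?subr_ge0 // df0 //.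
Qed.

(** Both [h - f] and [h + f] have nonnegative derivatives and start nonnegative. *)
Lemma norm_derive_le (R : realType) (f df h dh : R -> R) :
    (forall t : R, 0 <= t -> is_derive t 1 f (df t)) ->
    (forall t : R, 0 <= t -> is_derive t 1 h (dh t)) ->
    (forall t : R, 0 <= t -> `|df t| <= dh t) -> `|f 0| <= h 0 ->
  forall t : R, 0 <= t -> `|f t| <= h t.
Proof.
move=> fdf hdh dfh; rewrite ler_norml => /andP[f0 h0] t t0.
have B : h 0 - f 0 <= h t - f t.
  apply: (@ge0_derive_le _ (h - f) (fun s => dh s - df s)) => // s /andP[s0 _].
    by have := fdf s s0; have := hdh s s0 => ? ?; apply: is_deriveB.
  by rewrite subr_ge0 (le_trans (ler_norm _)) // dfh.
have A : h 0 + f 0 <= h t + f t.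
  apply: (@ge0_derive_le _ (h + f) (fun s => dh s + df s)) => // s /andP[s0 _].
    by have := fdf s s0; have := hdh s s0 => ? ?; apply: is_deriveD.
  by rewrite -lerBlDr sub0r (le_trans _ (dfh s s0)) // -normrN ler_norm.
rewrite ler_norml; apply/andP; split; lra.
Qed.

(** The integral starts at -1 so that every [t >= 0], 0 included, is interior and the derivative is
    two-sided. *)
Lemma continuous_primitive (R : realType) (h : R -> R) : continuous h ->
  exists2 H : R -> R, H 0 = 0 & forall t : R, 0 <= t -> is_derive t 1 H (h t).
Proof.
move=> hc; pose mu := @lebesgue_measure R.
pose I x := (\int[mu]_(s in `[-1, x]) h s)%R.
exists (fun x => I x - I 0); first by rewrite subrr.
move=> t t0.
have [| | |dI <-] := @continuous_FTC1_closed R h (-1) t (t + 1) _ _ _ (hc t).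
- by rewrite ltrDl.
- by apply: continuous_compact_integrable;
    [exact: segment_compact|exact: continuous_subspaceT].
- by rewrite (lt_le_trans _ t0).
rewrite derive1E -[X in is_derive _ _ _ X]subr0.
have := derivableP dI => dI'; exact: (@is_deriveB _ _ _ I (cst (I 0)) t 1 _ 0 dI' (is_derive_cst _ _ _)).
Qed.

(** At the infimum of the set of failures, [P] holds by the first hypothesis; by the second it holds
    on a neighbourhood, which excludes failures arbitrarily close to the infimum. *)
Lemma real_induction (R : realType) (P : R -> Prop) :
    (forall t : R, 0 <= t -> (forall s, 0 <= s < t -> P s) -> P t) ->
    (forall t : R, 0 <= t -> P t -> \forall s \near t, P s) ->
  forall t : R, 0 <= t -> P t.
Proof.
move=> Pcl Pop t t0; apply: contrapT => nPt.
pose S := [set s | 0 <= s /\ ~ P s].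
have S0 : S !=set0 by exists t.
have lS : has_inf S by split => //; exists 0 => s [].
pose i := inf S.
have i0 : 0 <= i by apply: lb_le_inf => // s [].
have Pi : P i.
  apply: Pcl => // s /andP[s0 si]; apply: contrapT => nPs.
  by move: si; rewrite ltNge => /negP; apply; apply: ge_inf => //; case: lS.
have /nbhs_ballP[e /= e0 eP] := Pop _ i0 Pi.
have [s [s0 nPs] sie] := inf_adherent e0 lS.
apply/nPs/eP => /=.
have le_is : i <= s by apply: ge_inf => //; case: lS.
by rewrite /ball/= distrC ger0_norm ?subr_ge0 // ltrBlDl.
Qed.

(** The brackets [a k - 2 * C / 2 ^+ k] and [a k + 2 * C / 2 ^+ k] are nondecreasing and
    nonincreasing, so the supremum of the lower ones lies in all of them. Applied at each time, this
    gives the limit of the Picard iterates with its rate. *)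
Lemma summable_increments_limit (R : realType) (a : nat -> R) (C : R) :
    (forall k, `|a k.+1 - a k| <= C / 2 ^+ k) ->
  exists l, forall k, `|l - a k| <= 2 * C / 2 ^+ k.
Proof.
move=> aC; pose b k := a k - 2 * C / 2 ^+ k; pose c k := a k + 2 * C / 2 ^+ k.
have C0 k : 0 <= C / 2 ^+ k by apply: le_trans (aC k); exact: normr_ge0.
have E k : 2 * C / 2 ^+ k.+1 = C / 2 ^+ k by rewrite exprS; field; rewrite expf_neq0 //; lra.
have E' k : 2 * C / 2 ^+ k = C / 2 ^+ k *+ 2 by rewrite -mulrA mulr2n; ring.
have bS k : b k <= b k.+1.
  by move: (aC k); rewrite /b E E' ler_norml => /andP[]; lra.
have cS k : c k.+1 <= c k.
  by move: (aC k); rewrite /c E E' ler_norml => /andP[]; lra.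
have bm : {homo b : i j / (i <= j)%N >-> i <= j}.
  by apply: homo_leq bS; [exact: lexx|exact: le_trans].
have cm : {homo c : i j / (i <= j)%N >-> j <= i}.
  by apply: homo_leq cS; [exact: lexx|move=> x y z yx zy; exact: le_trans zy yx].
have bc i j : b i <= c j.
  rewrite (le_trans (bm _ _ (leq_maxl i j)))// (le_trans _ (cm _ _ (leq_maxr i j)))//.
  by rewrite /b /c E'; have := C0 (maxn i j); lra.
have sb : has_sup (range b).
  by split; [exists (b 0%N), 0%N|exists (c 0%N) => _ [i _ <-]].
exists (sup (range b)) => k.
have : b k <= sup (range b) by apply: ub_le_sup; [case: sb|exists k].
have : sup (range b) <= c k by apply: ge_sup; [exists (b 0%N), 0%N|move=> _ [i _ <-]].
by rewrite /b /c ler_norml; lra.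
Qed.

Lemma is_derive_expR_linear (R : realType) (a t : R) :
  is_derive t 1 (fun s => expR (a * s)) (a * expR (a * t)).
Proof.
have D1 : is_derive t 1 (fun s : R => a * s) a.
  rewrite -[X in is_derive _ _ _ X]mulr1.
  exact: (@is_deriveZ _ _ _ id a t 1 1 (is_derive_id _ _)).
have D2 := @is_derive1_comp _ expR (fun s : R => a * s) t _ _ (is_derive_expR _) D1.
by apply: (is_derive_eq D2); rewrite mulrC.
Qed.

(** * Slopes, one-sided derivatives and local Lipschitz bounds *)

Lemma near_dnbhs0_shift (R : realType) (t : R) (P : R -> Prop) :
  (\forall h \near 0^', P (h + t)) <-> (\forall y \near t^', P y).
Proof.
split=> /nbhs_ballP[e /= e0 He]; apply/nbhs_ballP; exists e => //= y yB yt.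
- rewrite -(subrK t y); apply: He; last by rewrite subr_eq0.
  by move: yB; rewrite /ball/= sub0r opprB.
- apply: He; last by rewrite -subr_eq0 addrK.
  by move: yB; rewrite /ball/= sub0r opprD addrCA subrr addr0.
Qed.

Lemma is_derive_slopeP (R : realType) (f : R -> R) (t l : R) :
  is_derive t 1 f l <-> (fun y => (y - t)^-1 *: (f y - f t)) @ t^' --> l.
Proof.
have E : ((fun h => h^-1 *: ((f \o shift t) (h *: 1) - f t)) @ 0^' --> l) <->
    ((fun y => (y - t)^-1 *: (f y - f t)) @ t^' --> l).
  split=> /cvgrPdist_le fl; apply/cvgrPdist_le => e /fl.
  - move=> H; apply/near_dnbhs0_shift; apply: filterS H => h /=.
    by rewrite addrK /GRing.scale /= mulr1.
  - move=> /near_dnbhs0_shift; apply: filterS => h /=.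
    by rewrite addrK /GRing.scale /= mulr1.
split=> [[df dfE]|/E fl]; first by apply/E; rewrite -dfE; exact: df.
by split; [apply/cvg_ex; exists l|exact/cvg_lim].
Qed.

(** Restricting to [D] only refines the filter, and the norm of a row is the maximum of its
    coordinates. *)
Lemma is_derive_within (R : realType) m (D : set R) (x : R -> 'rV[R]_m) (t : R)
    (l : 'rV[R]_m) :
    (forall j, is_derive t 1 (fun s => x s 0 j) (l 0 j)) ->
  has_derivative_within D x t l.
Proof.
move=> xl; apply: (cvg_trans (G := (fun y => (y - t)^-1 *: (x y - x t)) @ t^')).
  by apply: cvg_app; exact: cvg_within.
apply/cvgrPdist_le => e e0; near=> y.
rewrite [leLHS]/Num.Def.normr/= mx_normrE (bigmax_le _ (ltW e0))//= => -[i j] _ /=.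
rewrite !mxE ord1; move: j; near: y; apply: filter_forall => j.
have /is_derive_slopeP/cvgrPdist_le/(_ _ e0) := xl j.
by [].
Unshelve. all: by end_near. Qed.

Lemma has_derivative_within_interior (R : realType) (h : R -> R) (x l : R) :
  0 < x -> has_derivative_within `[0, +oo[ h x l -> is_derive x 1 h l.
Proof.
move=> x0 hl; apply/is_derive_slopeP.
apply: cvg_trans hl; apply: cvg_app => A /= A0.
have xp : \forall y \near x, 0 < y by exact: lt_nbhsr.
have {}A0 : \forall y \near x, y != x -> `[0, +oo[%classic y -> A y := A0.
suff : \forall y \near x, y != x -> A y by [].
apply: filterS2 A0 xp => y A0 yp yx; apply: A0 => //.
by rewrite /= in_itv /= andbT ltW.
Qed.

Lemma norm_row_le (R : realType) m (x : 'rV[R]_m) (e : R) : 0 <= e ->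
  (forall j, `|x 0 j| <= e) -> `|x| <= e.
Proof.
move=> e0 xe; rewrite [leLHS]/Num.Def.normr/= mx_normrE.
by rewrite (bigmax_le _ e0)//= => -[i j] _; rewrite ord1.
Qed.

Lemma coord_le_norm (R : realType) m (x : 'rV[R]_m) j : `|x 0 j| <= `|x|.
Proof.
by rewrite [leRHS]/Num.Def.normr/= mx_normrE; exact: (le_bigmax _ _ (0, j)).
Qed.

(** Near [x] the derivative is bounded by [|dh x| + 1], and the mean value theorem concludes. The
    radius is quantified by a filter so that several such conditions can be met by one radius. *)
Lemma C1_Rplus_lipschitz_near (R : realType) (h dh : R -> R) (x : R) :
    C1_Rplus h dh -> 0 < x ->
  exists2 M, 0 <= M & \forall r \near 0^'+, forall a b,
    `|a - x| <= r -> `|b - x| <= r -> `|h a - h b| <= M * `|a - b|.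
Proof.
move=> [hdh dhc] x0; exists (`|dh x| + 1); first by rewrite addr_ge0.
have dhx : {for x, continuous dh}.
  by have /continuous_within_itvcyP[+ _] := dhc; apply; rewrite in_itv /= x0.
have : \forall y \near x, 0 < y /\ `|dh y| <= `|dh x| + 1.
  near=> y; split; first by near: y; exact: lt_nbhsr.
  have : `|dh x - dh y| <= 1 by near: y; move/cvgrPdist_le : dhx; apply.
  by move=> H; rewrite -lerBlDl (le_trans _ H) // distrC lerB_dist.
move=> /nbhs_ballP[e /= e0 He]; near=> r => a b ar br.
have re : r < e by near: r; exact: nbhs_right_lt.
wlog ab : a b ar br / a <= b.
  move=> H; case: (leP a b) => [|/ltW] ab; first exact: H.
  by rewrite distrC [`|a - b|]distrC H.
have inball y : a <= y <= b -> 0 < y /\ `|dh y| <= `|dh x| + 1.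
  move=> /andP[ay yb]; apply: He; rewrite /ball/= distrC (le_lt_trans _ re) //.
  by move: ar br; rewrite !ler_norml => /andP[? ?] /andP[? ?]; apply/andP; split; lra.
have hD y : a <= y <= b -> is_derive y 1 h (dh y).
  move=> /inball[y0 _]; apply: has_derivative_within_interior => //.
  by apply: hdh; exact: ltW.
have [||t tab E] := @MVT_segment _ h dh a b ab.
- by move=> y /[!in_itv]/= /andP[/ltW ay /ltW yb]; apply: hD; rewrite ay.
- apply: derivable_within_continuous => y /[!in_itv]/= yab.
  by have := hD _ yab; case.
rewrite distrC E normrM [`|a - b|]distrC ler_wpM2r //.
by apply: (proj2 (inball t _)); move: tab; rewrite in_itv.
Unshelve. all: by end_near. Qed.

(** The derivative is the limit of the slopes from the right; the rates [c i] will be compared only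
    to the right of [qu]. *)
Lemma is_derive_le0 (R : realType) (h : R -> R) (x l : R) :
  is_derive x 1 h l -> (\forall y \near x^'+, h y <= h x) -> l <= 0.
Proof.
move=> /is_derive_slopeP/cvg_dnbhs_at_right hl hx.
rewrite -(cvg_lim (@Rhausdorff R) hl); apply: limr_le; first by apply/cvg_ex; exists l.
near=> y; rewrite /GRing.scale /= mulrC; apply: mulr_le0_ge0.
  by rewrite subr_le0; near: y.
by rewrite invr_ge0 subr_ge0; near: y; exact: nbhs_right_ge.
Unshelve. all: by end_near. Qed.

(** Near [qu] the price multiplies distances by [beta], so a radius [r] in [q] becomes [beta * r] in
    the argument of [f i]. *)
Lemma near_right0_scale (R : realType) (b : R) (P : R -> Prop) : 0 < b ->
  (\forall r \near 0^'+, P r) -> \forall r \near 0^'+, P (b * r).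
Proof.
move=> b0 /nbhs_ballP[e /= e0 He]; apply/nbhs_ballP; exists (e / b) => /=.
  by rewrite divr_gt0.
move=> y yB y0; apply: He; last by rewrite mulr_gt0.
move: yB; rewrite /ball/= !sub0r !normrN ltr_pdivlMr //.
by rewrite normrM (gtr0_norm b0) mulrC.
Qed.

(** * Picard iteration *)

Section picard.
Variables (R : realType) (m : nat) (G : ('I_m -> R) -> 'I_m -> R) (L : R).
Hypothesis L_gt0 : 0 < L.
Hypothesis G_lip : forall (x y : 'I_m -> R) (e : R),
  (forall j, `|x j - y j| <= e) -> forall j, `|G x j - G y j| <= L * e.
Variable x0 : 'I_m -> R.

Let path_continuous (v : 'I_m -> R -> R) : (forall i, continuous (v i)) ->
  forall j, continuous (fun s => G (v ^~ s) j).
Proof.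
move=> vc j s; apply/cvgrPdist_le => e e0.
have eL : 0 < e / L by rewrite divr_gt0.
near=> t; have -> : e = L * (e / L) by rewrite mulrC divfK ?gt_eqF.
apply: G_lip; near: t; apply: filter_forall => i.
by move/cvgrPdist_le : (vc i s) => /(_ _ eL).
Unshelve. all: by end_near. Qed.

Let max0_continuous (f : R -> R) : (forall t : R, 0 <= t -> derivable f t 1) ->
  continuous (fun s : R => f (Num.max s 0)).
Proof.
move=> df t; apply: (@continuous_comp _ _ _ (fun s : R => Num.max s 0) f).
  by apply: continuous_max => //; exact: cvg_cst.
apply/differentiable_continuous/derivable1_diffP/df.
by rewrite le_max lexx orbT.
Qed.

Let step (v : 'I_m -> R -> R) : (forall i, continuous (v i)) ->
  exists u : 'I_m -> R -> R, forall j, u j 0 = x0 j /\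
    forall t : R, 0 <= t -> is_derive t 1 (u j) (G (v ^~ t) j).
Proof.
move=> vc.
have /choice[H HP] j : exists H : R -> R, H 0 = 0 /\
    forall t : R, 0 <= t -> is_derive t 1 H (G (v ^~ t) j).
  by have [H H0 HD] := continuous_primitive (@path_continuous v vc j); exists H.
exists (fun j t => x0 j + H j t) => j; have [H0 HD] := HP j.
rewrite H0 addr0; split => // t t0.
rewrite -[X in is_derive _ _ _ X]add0r.
exact: (@is_deriveD _ _ _ (cst (x0 j)) (H j) t 1 0 _ (is_derive_cst _ _ _) (HD t t0)).
Qed.

(** Iterates are controlled on [[0, +oo[] only, while [step] asks for continuity on the whole line;
    negative times get the value at 0. *)
Let clock (v : 'I_m -> R -> R) := fun i (s : R) => v i (Num.max s 0).

Let admissible (u : 'I_m -> R -> R) :=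
  forall i (t : R), 0 <= t -> derivable (u i) t 1.

Let iterates : exists u : nat -> 'I_m -> R -> R,
  [/\ forall j t, u 0%N j t = x0 j,
      forall k, admissible (u k),
      forall k j, u k j 0 = x0 j &
      forall k j (t : R), 0 <= t -> is_derive t 1 (u k.+1 j) (G (u k ^~ t) j)].
Proof.
have /choice[N NP] (v : 'I_m -> R -> R) : exists u : 'I_m -> R -> R,
    admissible v -> forall j, u j 0 = x0 j /\
    forall t : R, 0 <= t -> is_derive t 1 (u j) (G (v ^~ t) j).
  (* Choice needs a total operator; a path that is not admissible is returned as a dummy value. *)
  have [av|nav] := pselect (admissible v); last by exists v.
  have [|u uP] := @step (clock v); first by move=> i; apply: max0_continuous => ?; exact: av.
  exists u => _ j; have [-> uD] := uP j; split => // t t0.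
  have -> : v ^~ t = clock v ^~ t; last exact: uD.
  by apply/funext => i; rewrite /clock max_l.
pose u k := iter k N (fun j _ => x0 j).
have ua k : admissible (u k).
  elim: k => [|k IH] i t t0; first exact: derivable_cst.
  by have [_ /(_ _ t0)[]] := NP _ IH i.
exists u; split => // [[|k] j //|k j t t0].
  by have [] := NP _ (ua k) j.
by have [_ /(_ _ t0)] := NP _ (ua k) j.
Qed.

Let is_derive_weight (a t : R) :
  is_derive t 1 (fun s => a * expR (2 * L * s)) (2 * L * (a * expR (2 * L * t))).
Proof.
have D2 := is_derive_expR_linear (2 * L) t.
have D := @is_deriveZ _ _ _ (fun s : R => expR (2 * L * s)) a t 1 _ D2.
by apply: (is_derive_eq D); rewrite /GRing.scale /= mulrCA.
Qed.

(* The weight [expR (2 * L * t)] turns the Picard operator into a contraction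
   of ratio 1/2 on all of [0, +oo[ at once. *)
Lemma picard_global : exists u : 'I_m -> R -> R, forall j, u j 0 = x0 j /\
  forall t : R, 0 <= t -> is_derive t 1 (u j) (G (u ^~ t) j).
Proof.
have [u [u0 ua uini uD]] := iterates.
pose E t := expR (2 * L * t).
have E1 (t : R) : 0 <= t -> 1 <= E t.
  by move=> t0; rewrite /E -expR0 ler_expR mulr_ge0 // mulr_ge0 // ltW.
(* Chosen so that [2 * L * C] bounds the speed of the first iterate. *)
pose C := (\sum_j `|G x0 j|) / (2 * L).
have C0 : 0 <= C by rewrite divr_ge0 ?sumr_ge0 // ?mulr_ge0 // ltW.
have CE (t : R) k : 0 <= C * E t / 2 ^+ k.
  by rewrite divr_ge0 ?exprn_ge0 // mulr_ge0 // expR_ge0.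
(* The derivative of an increment is at most [L] times the previous bound, and the derivative of the
   weight brings a factor [2 * L]: the bound is halved. *)
have incr k (t : R) : 0 <= t -> forall j, `|u k.+1 j t - u k j t| <= C * E t / 2 ^+ k.
  elim: k t => [|k IH] t t0 j; rewrite [leRHS]mulrAC.
    apply: (norm_derive_le (f := fun s => u 1%N j s - u 0%N j s)
      (df := fun s => G (u 0%N ^~ s) j - 0) _ (fun s _ => is_derive_weight _ s) _ _ t0).
    - move=> s s0; apply: is_deriveB; first exact: uD.
      have -> : u 0%N j = cst (x0 j) by apply/funext => r; rewrite u0.
      exact: is_derive_cst.
    - move=> s s0; rewrite subr0 expr0 divr1.
      have -> : u 0%N ^~ s = x0 by apply/funext => r; rewrite u0.
      rewrite mulrA (_ : 2 * L * C = \sum_j `|G x0 j|); last first.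
        by rewrite mulrC divfK // gt_eqF // mulr_gt0.
      apply: le_trans (_ : \sum_j `|G x0 j| <= _).
        by rewrite (bigD1 j)//= lerDl sumr_ge0.
      by rewrite ler_peMr ?sumr_ge0 // E1.
    - by rewrite !uini subrr normr0 mulrAC; exact: CE.
  apply: (norm_derive_le (f := fun s => u k.+2 j s - u k.+1 j s)
    (df := fun s => G (u k.+1 ^~ s) j - G (u k ^~ s) j) _
    (fun s _ => is_derive_weight _ s) _ _ t0).
  - by move=> s s0; apply: is_deriveB; exact: uD.
  - move=> s s0; rewrite (le_trans (G_lip (IH s s0) j)) //.
    rewrite le_eqVlt; apply/orP; left; apply/eqP.
    by rewrite exprS -/(E s); field; rewrite expf_neq0 //; lra.
  - by rewrite !uini subrr normr0 mulrAC; exact: CE.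
have max0_ge0 (t : R) : 0 <= Num.max t 0 by rewrite le_max lexx orbT.
have /choice[v vP] (p : 'I_m * R) : exists l, forall k,
    `|l - u k p.1 (Num.max p.2 0)| <= 2 * (C * E (Num.max p.2 0)) / 2 ^+ k.
  by apply: summable_increments_limit => k; exact: incr.
pose V i (t : R) := v (i, t).
have Vu k (t : R) i : 0 <= t -> `|V i t - u k i t| <= 2 * C / 2 ^+ k * E t.
  move=> t0; have := vP (i, t) k; rewrite /= max_l //.
  by rewrite -!mulrA [E t * _]mulrC.
have small (M e : R) : 0 < e -> exists k, M / 2 ^+ k < e.
  move=> e0; exists (Num.Def.archi_bound `|M / e|).
  set k := Num.Def.archi_bound _.
  rewrite ltr_pdivrMr ?exprn_gt0 // mulrC -ltr_pdivrMr //.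
  rewrite (le_lt_trans (ler_norm _)) // (lt_trans (archi_boundP (normr_ge0 _))) //.
  by rewrite -/k -natrX ltr_nat ltn_expl.
(* The convergence is uniform on []-oo, t + 1]], where the weight is bounded, so continuity passes
   to the limit. *)
have Vc i : continuous (V i).
  move=> t; apply/cvgrPdist_le => e e0.
  have e3 : 0 < e / 3 by rewrite divr_gt0.
  have [k ke] := small (2 * C * E (Num.max (t + 1) 0)) _ e3.
  have near_u (s : R) : s <= t + 1 -> `|V i s - u k i (Num.max s 0)| <= e / 3.
    move=> st; apply: le_trans (vP (i, s) k) _; apply: le_trans (ltW ke) => /=.
    rewrite ler_pM2r ?invr_gt0 ?exprn_gt0 // mulrA.
    apply: ler_wpM2l; first by rewrite mulr_ge0.
    rewrite ler_expR; apply: ler_wpM2l; first by rewrite mulr_ge0 // ltW.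
    by rewrite ge_max !le_max st lexx orbT.
  near=> s.
  have st : s <= t + 1 by apply/ltW; near: s; apply: lt_nbhsl; rewrite ltrDl.
  have us : `|u k i (Num.max t 0) - u k i (Num.max s 0)| <= e / 3.
    near: s; have := max0_continuous (ua k i) (x := t).
    by move/cvgrPdist_le => /(_ _ e3).
  have := near_u s st; have := near_u t; rewrite lerDl => /(_ ler01).
  by move: us; rewrite !ler_norml; lra.
(* [w] is the Picard image of the limit [V]. Both are within a multiple of [1 / 2 ^+ k] of [u k.+1],
   hence they agree on [[0, +oo[]. *)
have [w wP] := step Vc.
suff wV (t : R) i : 0 <= t -> w i t = V i t.
  exists w => j; have [-> wD] := wP j; split => // t t0.
  have -> : w ^~ t = V ^~ t by apply/funext => i; exact: wV.
  exact: wD.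
move=> t0; apply/eqP; rewrite -subr_eq0 -normr_eq0 eq_le normr_ge0 andbT.
apply/ler_addgt0Pl => e e0; rewrite addr0.
have [k ke] := small (2 * C * E t) e e0.
apply: le_trans (ltW ke).
have A : `|w i t - u k.+1 i t| <= C / 2 ^+ k * E t.
  apply: (norm_derive_le (f := fun s => w i s - u k.+1 i s)
    (df := fun s => G (V ^~ s) i - G (u k ^~ s) i) _
    (fun s _ => is_derive_weight _ s) _ _ t0).
  - by move=> s s0; apply: is_deriveB; [have [_] := wP i; exact|exact: uD].
  - move=> s s0; apply: le_trans (G_lip (e := 2 * C / 2 ^+ k * E s) _ i) _.
      by move=> l; exact: Vu.
    rewrite le_eqVlt; apply/orP; left; apply/eqP.
    by rewrite -/(E s); field; rewrite expf_neq0 //; lra.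
  - have [-> _] := wP i; rewrite uini subrr normr0 mulrAC; exact: CE.
have B := Vu k.+1 t i t0.
rewrite -(subrKA (u k.+1 i t)) (le_trans (ler_normD _ _)) // [`|_ - V i t|]distrC.
rewrite (le_trans (lerD A B)) // le_eqVlt; apply/orP; left; apply/eqP.
by rewrite exprS; field; rewrite expf_neq0 //; lra.
Unshelve. all: by end_near. Qed.
End picard.

(** * Instability of cooperative systems *)

Definition clamp (R : realDomainType) (r a : R) : R := Num.min (Num.max a 0) r.

Lemma clamp_itv (R : realDomainType) (r a : R) : 0 <= r -> 0 <= clamp r a <= r.
Proof.
by move=> r0; rewrite /clamp ge_min lexx orbT le_min r0 le_max lexx !orbT.
Qed.

Lemma clamp_id (R : realDomainType) (r a : R) : 0 <= a <= r -> clamp r a = a.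
Proof. by move=> /andP[a0 ar]; rewrite /clamp max_l // min_l. Qed.

Lemma clamp_lip (R : realFieldType) (r a b : R) : 0 <= r ->
  `|clamp r a - clamp r b| <= `|a - b|.
Proof.
move=> r0; have N (x y : R) : x - y <= `|x - y| /\ y - x <= `|x - y|.
  by rewrite ler_norm distrC ler_norm.
have [A B] := N a b; have := normr_ge0 (a - b); move: A B; move: `|_| => z A B z0.
rewrite ler_norml /clamp.
case: (leP a 0) => ?; case: (leP b 0) => ?; rewrite ?(min_l r0).
- by apply/andP; split; lra.
- by case: (leP b r) => ?; apply/andP; split; lra.
- by case: (leP a r) => ?; apply/andP; split; lra.
- by case: (leP a r) => ?; case: (leP b r) => ?; apply/andP; split; lra.
Qed.

(* The solution that escapes is that of [y' = F (xe + clamp y) + L (clamp y - y)],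
   which is globally Lipschitz and agrees with the original system in the box;
   the last term makes [expR (L t) y_j] nondecreasing, so that [y >= 0]. *)
Lemma cooperative_unstable (R : realType) (m : nat)
    (F : 'rV[R]_m.+1 -> 'rV[R]_m.+1) (D : set 'rV[R]_m.+1) (xe : 'rV[R]_m.+1)
    (w : 'I_m.+1 -> R) (r L k : R) :
    let box := [set y : 'rV[R]_m.+1 | forall j, 0 <= y 0 j <= r] in
    0 < r -> 0 < L -> 0 < k -> (forall j, 0 < w j) ->
    (forall y, box y -> D (xe + y)) ->
    (forall y z e, box y -> box z -> (forall j, `|y 0 j - z 0 j| <= e) ->
       forall j, `|F (xe + y) 0 j - F (xe + z) 0 j| <= L * e) ->
    (forall y j, box y -> 0 <= F (xe + y) 0 j + L * y 0 j) ->
    (forall y, box y ->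
       k * \sum_j w j * y 0 j <= \sum_j w j * F (xe + y) 0 j) ->
  ~ stable D F xe.
Proof.
(* Stability is used with tolerance [r], the size of the box: it would confine the solution to the
   box forever. *)
move=> box r0 L0 k0 w0 boxD Flip Fpos Fgrow /(_ r r0)[d d0 stab].
have r0' := ltW r0.
pose cl (y : 'I_m.+1 -> R) : 'rV[R]_m.+1 := \row_j clamp r (y j).
have clbox y : box (cl y) by move=> j; rewrite mxE clamp_itv.
pose G (y : 'I_m.+1 -> R) j := F (xe + cl y) 0 j + L * (clamp r (y j) - y j).
(* One [L] comes from [F], one from the clamp and one from the term [- y]. *)
have Glip (x y : 'I_m.+1 -> R) (e : R) : (forall j, `|x j - y j| <= e) ->
    forall j, `|G x j - G y j| <= (3 * L) * e.
  move=> xye j; have Cl i : `|clamp r (x i) - clamp r (y i)| <= e.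
    exact: le_trans (clamp_lip _ _ r0') (xye i).
  have := Flip (cl x) (cl y) e (clbox x) (clbox y) _ j.
  have /[swap]/[apply] : forall i, `|cl x 0 i - cl y 0 i| <= e by move=> i; rewrite !mxE.
  move: (Cl j) (xye j); rewrite /G !ler_norml => /andP[? ?] /andP[? ?] /andP[? ?].
  by apply/andP; split; nra.
(* All coordinates start at [dl]: within [d] of the fixed point and strictly inside the box. *)
pose dl := Num.min (d / 2) (r / 2).
have dl0 : 0 < dl by rewrite lt_min !divr_gt0.
have L3 : 0 < 3 * L by rewrite mulr_gt0.
have [u uP] := picard_global L3 Glip (fun=> dl).
have u0 j : u j 0 = dl by case: (uP j).
have uD j (t : R) : 0 <= t -> is_derive t 1 (u j) (G (u ^~ t) j) by case: (uP j) => _; exact.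
have uc j (t : R) : 0 <= t -> {for t, continuous (u j)}.
  by move=> t0; apply/differentiable_continuous/derivable1_diffP; case: (uD j t t0).
have u_ge0 j (t : R) : 0 <= t -> 0 <= u j t.
  move=> t0; have : expR (L * 0) * u j 0 <= expR (L * t) * u j t.
    apply: (@ge0_derive_le _ (fun s => expR (L * s) * u j s)
      (fun s => expR (L * s) * (F (xe + cl (u ^~ s)) 0 j + L * cl (u ^~ s) 0 j)) _ _ t0).
      move=> s /andP[s0 _]; have D2 := is_deriveM (is_derive_expR_linear L s) (uD j s s0).
      by apply: (is_derive_eq D2); rewrite /GRing.scale /= /G mxE; ring.
    by move=> s _; rewrite mulr_ge0 ?expR_ge0 // Fpos.
  rewrite mulr0 expR0 mul1r u0 => H; have : 0 < expR (L * t) * u j t by exact: lt_le_trans H.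
  by rewrite pmulr_rgt0 ?expR_gt0 // => /ltW.
pose x (t : R) : 'rV[R]_m.+1 := xe + \row_j u j t.
have sol (T : R) : (forall t j, 0 <= t <= T -> u j t <= r) -> ode_solution D F T x.
  move=> ur t tT; have /andP[t0 _] := tT.
  have bx : box (\row_j u j t) by move=> j; rewrite mxE u_ge0 // ur.
  split; first exact: boxD.
  have clE : cl (u ^~ t) = \row_j u j t.
    by apply/rowP => j; rewrite !mxE clamp_id // u_ge0 // ur.
  apply: is_derive_within => j.
  have -> : (fun s => x s 0 j) = (fun s => cst (xe 0 j) s + u j s).
    by apply/funext => s; rewrite /x !mxE.
  have D1 := @is_deriveD _ _ _ (cst (xe 0 j)) (u j) t 1 0 _ (is_derive_cst _ _ _) (uD j t t0).
  apply: (is_derive_eq D1).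
  by rewrite add0r /G clE clamp_id ?u_ge0 ?ur // subrr mulr0 addr0.
have x0 : `|x 0 - xe| < d.
  rewrite /x addrC addKr; apply: le_lt_trans (_ : d / 2 < d); last by lra.
  apply: norm_row_le => [|j]; first by rewrite divr_ge0 // ltW.
  by rewrite mxE u0 ger0_norm ?(ltW dl0) // /dl ge_min lexx.
(* Continuity induction. If the bound holds before [t], then [u j t <= r] by continuity, so [x]
   solves the original system on [[0, t]] and stability makes the bound strict at [t]; a strict
   bound persists nearby. *)
have ur (t : R) : 0 <= t -> forall j, u j t < r.
  apply: (@real_induction _ (fun t => forall j, u j t < r)) t => t t0 H; last first.
    have near_ur j : \forall s \near t, u j s < r.
      by have := uc j t t0; move=> /(_ [set z | z < r]) /(_ (lt_nbhsl (H j))).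
    exact: (@filter_forall _ _ (fun j s => u j s < r) (nbhs t) _ near_ur).
  have ule s j : 0 <= s <= t -> u j s <= r.
    move=> /andP[s0]; rewrite le_eqVlt => /predU1P[->|st]; last by rewrite ltW // H // s0.
    rewrite leNgt; apply/negP => rt.
    have [te|tn0] := eqVneq t 0.
      by move: rt; rewrite te u0; apply/negP; rewrite -leNgt /dl ge_min; apply/orP; right; lra.
    have tgt0 : 0 < t by rewrite lt_neqAle eq_sym tn0.
    have nr : \forall s \near t, r < u j s.
      by have := uc j t t0; move=> /(_ [set z | r < z]) /(_ (lt_nbhsr rt)).
    have /nbhs_ballP[e /= e0 He] := nr.
    pose s' := Num.max 0 (t - e / 2).
    have s't : s' < t by rewrite /s' gt_max tgt0 /= ltrBlDr ltrDl divr_gt0.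
    have : r < u j s'.
      apply: He; rewrite /ball/= ger0_norm; last by rewrite subr_ge0 ltW.
      by rewrite ltrBlDl -ltrBlDr /s' lt_max; apply/orP; right; lra.
    by apply/negP; rewrite -leNgt ltW // H // s't andbT /s' le_max lexx.
  move=> j; have := stab t x (sol t (fun s j => ule s j)) x0 t.
  rewrite t0 lexx => /(_ isT); apply: le_lt_trans.
  by apply: le_trans (coord_le_norm _ j); rewrite /x addrC addKr mxE ler_norm.
pose W := \sum_j w j.
have W0 : 0 < W by rewrite /W (bigD1 ord0)//= ltr_pwDl // sumr_ge0 // => ? _; exact: ltW.
pose z t := \sum_j w j * u j t.
have zD (t : R) : 0 <= t -> is_derive t 1 z (\sum_j w j * G (u ^~ t) j).
  move=> t0; have D1 := @is_derive_sum _ _ _ _ (fun j s => w j * u j s) t 1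
     (fun j => w j * G (u ^~ t) j) (fun j => @is_deriveZ _ _ _ (u j) (w j) t 1 _ (uD j t t0)).
  have -> // : z = \sum_(i < m.+1) (fun s => w i * u i s).
  by apply/funext => s; rewrite fct_sumE.
(* [expR (- k * t) * z t] is nondecreasing, by [Fgrow] along the solution. *)
have zgrow (t : R) : 0 <= t -> z 0 * expR (k * t) <= z t.
  move=> t0; have : expR (- k * 0) * z 0 <= expR (- k * t) * z t.
    apply: (@ge0_derive_le _ (fun s => expR (- k * s) * z s)
      (fun s => expR (- k * s) * (\sum_j w j * G (u ^~ s) j - k * z s)) _ _ t0).
      move=> s /andP[s0 _]; have D2 := is_deriveM (is_derive_expR_linear (- k) s) (zD s s0).
      by apply: (is_derive_eq D2); rewrite /GRing.scale /=; ring.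
    move=> s /andP[s0 _]; rewrite mulr_ge0 ?expR_ge0 // subr_ge0.
    have bx : box (\row_j u j s) by move=> j; rewrite mxE u_ge0 //= ltW // ur.
    have clE : cl (u ^~ s) = \row_j u j s.
      by apply/rowP => j; rewrite !mxE clamp_id // u_ge0 //= ltW // ur.
    have := Fgrow _ bx; rewrite /z; under eq_bigr do rewrite mxE.
    move=> H; apply: (le_trans H); rewrite le_eqVlt; apply/orP; left; apply/eqP.
    apply: eq_bigr => j _.
    by rewrite /G clE clamp_id ?subrr ?mulr0 ?addr0 // u_ge0 //= ltW // ur.
  by rewrite mulr0 expR0 mul1r mulNr expRN -ler_pdivrMl ?invr_gt0 ?expR_gt0 // invrK mulrC.
(* At this time [dl * (1 + k * t) = dl + r], so [z t >= W * dl * expR (k * t)] exceeds the bound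
   [W * r] valid in the box. *)
pose t := r / (dl * k).
have t0 : 0 <= t by rewrite divr_ge0 // ltW // mulr_gt0.
have := zgrow t t0; apply/negP; rewrite -ltNge.
have zt : z t <= W * r.
  by rewrite /z /W mulr_suml ler_sum // => j _; rewrite ler_pM2l // ltW // ur.
apply: (le_lt_trans zt).
have -> : z 0 = W * dl by rewrite /z /W mulr_suml; apply: eq_bigr => j _; rewrite u0.
rewrite -mulrA ltr_pM2l //; apply: lt_le_trans (_ : dl * (1 + k * t) <= _).
  rewrite /t mulrDr mulr1 (_ : dl * _ = r) ?ltrDr //.
  by field; rewrite !gt_eqF.
by rewrite ler_pM2l // expR_ge1Dx.
Qed.

(** The linear part of [w . F] is exactly [k * (w . y)]. As [w > 0] and [y >= 0], the norm of [y] is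
    bounded by a multiple of [w . y], so the remainder of the expansion is absorbed by half of the
    rate. *)
Lemma linear_growth_near (R : realType) m (F : 'rV[R]_m -> 'rV[R]_m)
    (xe : 'rV[R]_m) (w : 'I_m -> R) (k : R) :
    differentiable F xe -> F xe = 0 -> 0 < k -> (forall j, 0 < w j) ->
    (forall i, \sum_j jacobian F xe i j * w j = k * w i) ->
  \forall r \near 0^'+, forall y : 'rV[R]_m, (forall j, 0 <= y 0 j <= r) ->
    k / 2 * \sum_j w j * y 0 j <= \sum_j w j * F (xe + y) 0 j.
Proof.
move=> dF F0 k0 w0 Jw.
pose W := 1 + \sum_j w j; pose V := 1 + \sum_j (w j)^-1.
have W0 : 0 < W by rewrite ltr_pwDl // sumr_ge0 // => j _; exact: ltW.
have V0 : 0 < V by rewrite ltr_pwDl // sumr_ge0 // => j _; rewrite invr_ge0 ltW.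
(* [W] bounds the weighted sum of the remainders and [V] compares [|y|] with [z]; the choice makes
   [W * eta * V = k / 2]. *)
pose eta := k / 2 / W / V.
have eta0 : 0 < eta by rewrite !divr_gt0.
have /diff_locallyP[_ /eqaddoP/(_ eta eta0)/nbhs_ballP[e /= e0 He]] := dF.
near=> r => y yr.
have re : r < e by near: r; exact: nbhs_right_lt.
have r0 : 0 < r by near: r; exact: nbhs_right_gt.
have yle : `|y| <= r.
  apply: norm_row_le => [|j]; first exact: ltW.
  by have /andP[y0 yr'] := yr j; rewrite ger0_norm.
have yB : ball (0 : 'rV[R]_m) e y.
  by rewrite -ball_normE /ball_ /= sub0r normrN (le_lt_trans yle).
have := He y yB; rewrite /= !fctE F0 => Hy.
pose rest := F (y + xe) - (0 + 'd F xe y).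
have restE j : F (xe + y) 0 j = \sum_i y 0 i * jacobian F xe i j + rest 0 j.
  rewrite /rest add0r [y + _]addrC -[in 'd F xe y]mul_rV_lin1 -/(jacobian F xe).
  by rewrite !mxE addrCA subrr addr0.
pose z := \sum_j w j * y 0 j.
have y0 j : 0 <= y 0 j by have /andP[] := yr j.
have wy0 j : 0 <= w j * y 0 j by rewrite mulr_ge0 // ltW.
have yz : `|y| <= V * z.
  have z0 : 0 <= z by rewrite sumr_ge0.
  apply: norm_row_le => [|j]; first by rewrite mulr_ge0 // ltW.
  rewrite ger0_norm // -[y 0 j](mulKf (lt0r_neq0 (w0 j))).
  apply: ler_pM => //; first by rewrite invr_ge0 ltW.
    rewrite /V (bigD1 j)//= addrCA lerDl addr_ge0 // sumr_ge0 // => i _.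
    by rewrite invr_ge0 ltW.
  by rewrite /z (bigD1 j)//= lerDl sumr_ge0.
have linE : \sum_j w j * \sum_i y 0 i * jacobian F xe i j = k * z.
  rewrite /z mulr_sumr; under eq_bigr do rewrite mulr_sumr.
  rewrite exchange_big /=; apply: eq_bigr => i _.
  rewrite mulrA -Jw mulr_suml; apply: eq_bigr => j _; ring.
have restle : - (k / 2 * z) <= \sum_j w j * rest 0 j.
  have A : `|\sum_j w j * rest 0 j| <= W * (eta * (V * z)).
    apply: le_trans (_ : \sum_j w j * (eta * `|y|) <= _).
      rewrite (le_trans (ler_norm_sum _ _ _)) // ler_sum // => j _.
      rewrite normrM gtr0_norm // ler_pM2l //.
      by apply: le_trans (coord_le_norm _ j) _.
    rewrite -mulr_suml; apply: ler_pM.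
    - by rewrite sumr_ge0 // => j _; exact: ltW.
    - by rewrite mulr_ge0 // ltW.
    - by rewrite /W lerDr.
    - by rewrite ler_pM2l.
  move: A; have -> : W * (eta * (V * z)) = k / 2 * z.
    by rewrite /eta; field; rewrite !gt_eqF.
  by rewrite ler_norml => /andP[].
under [leRHS]eq_bigr do rewrite restE mulrDr.
by rewrite big_split /= linE -/z; lra.
Unshelve. all: by end_near. Qed.

(** * The vector field *)

(** Price, price responses and admission act on each [R_i] only through the total rate [c i], which
    is kept abstract. *)
Definition arrow_field (R : realType) (n : nat) (K : 'I_n -> R)
    (c : 'I_n -> R -> R) (a mu : R -> R) (x : 'rV[R]_n.+1) : 'rV[R]_n.+1 :=
  let q := x ord0 ord_max in
  state (fun i => K i - c i q * x ord0 (lift ord_max i))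
        (a q * (\sum_(i < n) x ord0 (lift ord_max i)) - mu q).

Lemma vfield_arrow (R : realType) (n : nat) (K : 'I_n -> R)
    (f : 'I_n -> R -> R) (alpha p mu : R -> R) :
  vfield K f alpha p mu =
  arrow_field K (fun i q => f i (p q) + alpha q) alpha mu.
Proof.
apply/funext => x; rewrite /vfield /arrow_field; congr state.
by apply/funext => i; ring.
Qed.

Lemma state_lift (R : realType) n (r : 'I_n -> R) q i :
  state r q 0 (lift ord_max i) = r i.
Proof. by rewrite mxE liftK. Qed.

Lemma state_max (R : realType) n (r : 'I_n -> R) q : state r q 0 ord_max = q.
Proof. by rewrite mxE unlift_none. Qed.

Lemma ord_max_ind n (P : 'I_n.+1 -> Prop) :
  (forall i, P (lift ord_max i)) -> P ord_max -> forall j, P j.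
Proof. by move=> Pl Pm j; case: (unliftP ord_max j) => [i ->|->]. Qed.

(** Supplies the Lipschitz and positivity hypotheses of [cooperative_unstable]. To the right of [q0]
    the rate [c i] is at most [c i q0], so with [K i = c i q0 * Rs i] the i-th component is at least
    [- c i q0] times the i-th displacement. *)
Lemma arrow_field_box (R : realType) (n : nat) (K : 'I_n -> R)
    (c : 'I_n -> R -> R) (a mu : R -> R) (Rs : 'I_n -> R) (q0 r M : R) :
    0 < r -> 0 <= M -> (forall i, 0 <= Rs i) ->
    (forall i q, q0 <= q <= q0 + r -> 0 <= c i q <= c i q0) ->
    (forall q, q0 <= q <= q0 + r -> 0 <= a q <= a q0) ->
    (forall i q q', q0 <= q <= q0 + r -> q0 <= q' <= q0 + r ->
       `|c i q - c i q'| <= M * `|q - q'|) ->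
    (forall q q', q0 <= q <= q0 + r -> q0 <= q' <= q0 + r ->
       `|a q - a q'| <= M * `|q - q'|) ->
    (forall q q', q0 <= q <= q0 + r -> q0 <= q' <= q0 + r ->
       `|mu q - mu q'| <= M * `|q - q'|) ->
    (forall i, K i = c i q0 * Rs i) -> a q0 * \sum_i Rs i = mu q0 ->
  let F := arrow_field K c a mu in
  let xe := state Rs q0 in
  let box := [set y : 'rV[R]_n.+1 | forall j, 0 <= y 0 j <= r] in
  exists L, [/\ 0 < L,
    forall y z e, box y -> box z -> (forall j, `|y 0 j - z 0 j| <= e) ->
       forall j, `|F (xe + y) 0 j - F (xe + z) 0 j| <= L * e &
    forall y j, box y -> 0 <= F (xe + y) 0 j + L * y 0 j].
Proof.
move=> r0 M0 Rs0 cb ab cl al mul KE muE F xe box.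
have xel y i : (xe + y) 0 (lift ord_max i) = Rs i + y 0 (lift ord_max i).
  by rewrite mxE state_lift.
have xem y : (xe + y) 0 ord_max = q0 + y 0 ord_max by rewrite mxE state_max.
have FE y i : F (xe + y) 0 (lift ord_max i) =
    K i - c i (q0 + y 0 ord_max) * (Rs i + y 0 (lift ord_max i)).
  by rewrite /F /arrow_field state_lift xel xem.
have FmE y : F (xe + y) 0 ord_max = a (q0 + y 0 ord_max) *
    (\sum_i (Rs i + y 0 (lift ord_max i))) - mu (q0 + y 0 ord_max).
  by rewrite /F /arrow_field state_max xem; under eq_bigr do rewrite xel.
have qr y : box y -> q0 <= q0 + y 0 ord_max <= q0 + r.
  by move=> /(_ ord_max); rewrite lerDl lerD2l.
have q0r : q0 <= q0 <= q0 + r by rewrite lexx lerDl ltW.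
have c0 i : 0 <= c i q0 by have /andP[] := cb i q0 q0r.
have a0 : 0 <= a q0 by have /andP[] := ab q0 q0r.
(* Bounds every [R_i], and their sum, throughout the box. *)
pose S := \sum_i (Rs i + r).
have RsS i : Rs i + r <= S.
  rewrite /S (bigD1 i)//= lerDl sumr_ge0 // => j _.
  by rewrite addr_ge0 // ltW.
have S0 : 0 <= S by rewrite sumr_ge0 // => j _; rewrite addr_ge0 // ltW.
have Rsum0 : 0 <= \sum_i Rs i by rewrite sumr_ge0.
have RsumS : \sum_i Rs i <= S by apply: ler_sum => i _; rewrite lerDl ltW.
pose C := \sum_i c i q0.
have cC i : c i q0 <= C by rewrite /C (bigD1 i)//= lerDl sumr_ge0.
have C0 : 0 <= C by rewrite sumr_ge0.
pose N : R := n%:R.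
have N0 : 0 <= N by exact: ler0n.
(* [C] and [N * a q0] account for changes of the [R_i] at fixed rates, [M * S] for changes of the
   rates, [M] for [mu]; the 1 makes [L] positive. *)
pose L := C + N * a q0 + M * S + M + 1.
have Na0 : 0 <= N * a q0 by rewrite mulr_ge0.
have MS0 : 0 <= M * S by rewrite mulr_ge0.
exists L; split; first by rewrite /L; lra.
- move=> y z e yb zb yze.
  have e0 : 0 <= e by apply: le_trans (yze ord_max); exact: normr_ge0.
  have dq : `|(q0 + y 0 ord_max) - (q0 + z 0 ord_max)| <= e.
    by rewrite opprD addrACA subrr add0r.
  have MdM (t : R) : t <= M * `|(q0 + y 0 ord_max) - (q0 + z 0 ord_max)| -> t <= M * e.
    by move=> /le_trans; apply; apply: ler_wpM2l.
  elim/ord_max_ind => [i|].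
    rewrite !FE.
    set cy := c i (q0 + y 0 ord_max); set cz := c i (q0 + z 0 ord_max).
    set yi := y 0 _; set zi := z 0 _.
    have -> : K i - cy * (Rs i + yi) - (K i - cz * (Rs i + zi)) =
       - (cy * (yi - zi) + (cy - cz) * (Rs i + zi)) by ring.
    rewrite normrN (le_trans (ler_normD _ _)) // !normrM.
    have /andP[cy0 cyc] := cb i _ (qr _ yb); rewrite -/cy in cy0 cyc.
    have /andP[z0 zr] := zb (lift ord_max i); rewrite -/zi in z0 zr.
    have A : `|cy| * `|yi - zi| <= C * e.
      by apply: ler_pM; rewrite ?yze // ger0_norm // (le_trans cyc).
    have B : `|cy - cz| * `|Rs i + zi| <= M * e * S.
      apply: ler_pM => //; first by rewrite MdM ?cl ?qr.
      by rewrite ger0_norm ?addr_ge0 // (le_trans _ (RsS i)) // lerD2l.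
    rewrite (le_trans (lerD A B)) // /L; nra.
  rewrite !FmE.
  set ay := a (q0 + y 0 ord_max); set az := a (q0 + z 0 ord_max).
  set my := mu (q0 + y 0 ord_max); set mz := mu (q0 + z 0 ord_max).
  set sy := \sum_i _; set sz := \sum_i _.
  have -> : ay * sy - my - (az * sz - mz) =
     ay * (sy - sz) + ((ay - az) * sz - (my - mz)) by ring.
  have /andP[ay0 aya] := ab _ (qr _ yb); rewrite -/ay in ay0 aya.
  have A : `|ay * (sy - sz)| <= a q0 * (N * e).
    rewrite normrM; apply: ler_pM; rewrite ?(ger0_norm ay0) // /sy /sz -sumrB.
    rewrite (le_trans (ler_norm_sum _ _ _)) //.
    rewrite (le_trans (ler_sum _ (G := fun=> e) _)) //.
      by move=> i _; rewrite opprD addrACA subrr add0r.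
    by rewrite sumr_const card_ord -mulr_natl.
  have B : `|(ay - az) * sz| <= M * e * S.
    rewrite normrM; apply: ler_pM => //; first by rewrite MdM ?al ?qr.
    rewrite ger0_norm; last first.
      by rewrite sumr_ge0 // => i _; rewrite addr_ge0 //; have /andP[] := zb (lift ord_max i).
    by apply: ler_sum => i _; rewrite lerD2l; have /andP[] := zb (lift ord_max i).
  have D : `|my - mz| <= M * e by rewrite MdM ?mul ?qr.
  rewrite (le_trans (ler_normD _ _)) // (le_trans (lerD A (ler_normB _ _))) //.
  rewrite addrA (le_trans (lerD (lerD (lexx _) B) D)) // /L; nra.
move=> y j yb; elim/ord_max_ind: j => [i|].
  rewrite FE KE.
  have /andP[cy0 cyc] := cb i _ (qr _ yb).
  have /andP[y0 yr] := yb (lift ord_max i).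
  have A : c i (q0 + y 0 ord_max) * (Rs i + y 0 (lift ord_max i)) <=
      c i q0 * (Rs i + y 0 (lift ord_max i)).
    by rewrite ler_wpM2r // addr_ge0.
  have B : c i q0 * y 0 (lift ord_max i) <= L * y 0 (lift ord_max i).
    by rewrite ler_wpM2r // (le_trans (cC i)) // /L; lra.
  by move: A B; rewrite mulrDr; lra.
(* Inflow and outflow balance at [q0]. A displacement of [q] lowers the inflow by at most
   [M * \sum_i Rs i] times itself and raises the outflow by at most [M] times itself, while
   displacements of the [R_i] only add inflow. *)
rewrite FmE.
have /andP[y0 yr] := yb ord_max.
have /andP[ay0 aya] := ab _ (qr _ yb).
have A : a (q0 + y 0 ord_max) * \sum_i Rs i <=
    a (q0 + y 0 ord_max) * \sum_i (Rs i + y 0 (lift ord_max i)).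
  rewrite ler_wpM2l // ler_sum // => i _; rewrite lerDl.
  by have /andP[] := yb (lift ord_max i).
have := al _ _ (qr _ yb) q0r; have := mul _ _ (qr _ yb) q0r.
have -> : q0 + y 0 ord_max - q0 = y 0 ord_max by ring.
rewrite (ger0_norm y0) !ler_norml => /andP[_ m1] /andP[a1 _].
have B : (a q0 - M * y 0 ord_max) * \sum_i Rs i <= a (q0 + y 0 ord_max) * \sum_i Rs i.
  by rewrite ler_wpM2r //; lra.
have D : M * y 0 ord_max * \sum_i Rs i <= M * y 0 ord_max * S.
  by rewrite ler_wpM2l // mulr_ge0.
have E : 0 <= (C + N * a q0 + 1) * y 0 ord_max by rewrite mulr_ge0 //; lra.
move: A B D E m1 muE; rewrite /L; nra.
Qed.

(** * Differential and Jacobian of the field *)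

Lemma is_diff_coord (R : realType) m (x : 'rV[R]_m) (j : 'I_m) :
  is_diff x (fun y : 'rV[R]_m => y 0 j : R^o) (fun v => v 0 j).
Proof.
have clin : linear (fun y : 'rV[R]_m => y 0 j : R^o).
  by move=> a u v; rewrite !mxE.
pose cM := GRing.isLinear.Build _ _ _ _ _ clin.
pose cL : {linear _ -> _} := HB.pack (fun y : 'rV[R]_m => y 0 j : R^o) cM.
have cc : continuous cL by exact: coord_continuous.
by apply: DiffDef; [exact: (linear_differentiable x cc)|exact: (diff_lin x cc)].
Qed.

(** [F] is the sum of its coordinates times the unit rows; its differential is then read off by
    composing with each coordinate. *)
Lemma is_diff_row (R : realType) (V : normedModType R) m (F : V -> 'rV[R]_m)
    (x : V) (dF : 'I_m -> V -> R^o) :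
    (forall j, is_diff x (fun y => F y 0 j : R^o) (dF j)) ->
  differentiable F x /\ forall v j, 'd F x v 0 j = dF j v.
Proof.
move=> FdF.
have FE : F = \sum_(j < m) (fun y => (F y 0 j : R^o) *: delta_mx 0 j).
  by apply/funext => y; rewrite fct_sumE [LHS]row_sum_delta.
have dfF : differentiable F x.
  rewrite FE; apply: differentiable_sum => j; apply: differentiableZl.
  by case: (FdF j).
split=> // v j.
have D1 := is_diff_comp (differentiableP dfF) (is_diff_coord (F x) j).
have E1 := @diff_val _ _ _ _ _ _ _ D1.
have E2 := @diff_val _ _ _ _ _ _ _ (FdF j).
by have := congr1 (fun h : V -> R => h v) (etrans (esym E1) E2).
Qed.

Lemma is_derive_is_diff (R : realType) (h : R -> R) (x l : R) :
  is_derive x 1 h l -> is_diff x (h : R^o -> R^o) (fun s => s * l).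
Proof.
move=> hl; have dh : differentiable (h : R^o -> R^o) x.
  by apply/derivable1_diffP; case: hl.
apply: DiffDef => //; rewrite diff1E //; apply/funext => s /=.
by rewrite derive1E; case: hl => _ ->.
Qed.

(** The row index is the variable of differentiation: [J (lift ord_max i) ord_max] is the derivative
    of the last component with respect to [R_i]. *)
Lemma arrow_field_diff (R : realType) (n : nat) (K : 'I_n -> R)
    (c : 'I_n -> R -> R) (a mu : R -> R) (Rs dc : 'I_n -> R) (q0 da dmu : R) :
    (forall i, is_derive q0 1 (c i) (dc i)) -> is_derive q0 1 a da ->
    is_derive q0 1 mu dmu ->
  let F := arrow_field K c a mu in
  let xe := state Rs q0 in
  let J := jacobian F xe in
  [/\ differentiable F xe,
    forall i j, J (lift ord_max i) (lift ord_max j) = - c i q0 *+ (i == j),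
    forall i, J (lift ord_max i) ord_max = a q0,
    forall i, J ord_max (lift ord_max i) = - (dc i * Rs i) &
    J ord_max ord_max = da * \sum_i Rs i - dmu].
Proof.
move=> cD aD muD F xe J.
pose dF (j : 'I_n.+1) (v : 'rV[R]_n.+1) : R^o :=
  if unlift ord_max j is Some i then
    - (c i q0 * v 0 (lift ord_max i) + Rs i * (v 0 ord_max * dc i))
  else a q0 * (\sum_i v 0 (lift ord_max i)) +
       (\sum_i Rs i) * (v 0 ord_max * da) - v 0 ord_max * dmu.
have qD := is_diff_coord xe ord_max.
have compD (h : R -> R) l : is_derive q0 1 h l ->
    is_diff xe (fun y : 'rV[R]_n.+1 => h (y 0 ord_max) : R^o) (fun v => v 0 ord_max * l).
  move=> hl.
  have hD : is_diff (xe 0 ord_max : R^o) (h : R^o -> R^o) (fun s => s * l).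
    by rewrite state_max; exact: is_derive_is_diff.
  exact: (is_diff_comp qD hD).
have sumD : is_diff xe (fun y : 'rV[R]_n.+1 => \sum_i y 0 (lift ord_max i) : R^o)
    (fun v => \sum_i v 0 (lift ord_max i)).
  have clin : linear (fun y : 'rV[R]_n.+1 => \sum_i y 0 (lift ord_max i) : R^o).
    move=> b u v; rewrite scaler_sumr -big_split /=.
    by apply: eq_bigr => i _; rewrite !mxE.
  pose cM := GRing.isLinear.Build _ _ _ _ _ clin.
  pose cL : {linear _ -> _} := HB.pack
    (fun y : 'rV[R]_n.+1 => \sum_i y 0 (lift ord_max i) : R^o) cM.
  have cc : continuous cL.
    have -> : cL = \sum_i (fun y : 'rV[R]_n.+1 => y 0 (lift ord_max i) : R^o) :> (_ -> _).
      by apply/funext => y; rewrite fct_sumE.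
    by move=> y; apply/differentiable_continuous/differentiable_sum => i;
      case: (is_diff_coord y (lift ord_max i)).
  by apply: DiffDef; [exact: (linear_differentiable xe cc)|exact: (diff_lin xe cc)].
have [|dfF dFE] := @is_diff_row R _ _ F xe dF.
  elim/ord_max_ind => [i|].
    have -> : (fun y => F y 0 (lift ord_max i) : R^o) = cst (K i : R^o) -
        (fun y : 'rV[R]_n.+1 => c i (y 0 ord_max)) * (fun y : 'rV[R]_n.+1 => y 0 (lift ord_max i)).
      by apply/funext => y; rewrite /F /arrow_field state_lift.
    have D := is_diffB (is_diff_cst (K i : R^o) xe)
      (is_diffM (compD _ _ (cD i)) (is_diff_coord xe (lift ord_max i))).
    apply: (is_diff_eq D); apply/funext => v.
    by rewrite /dF liftK /= state_max state_lift sub0r.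
  have -> : (fun y => F y 0 ord_max : R^o) =
      (fun y : 'rV[R]_n.+1 => a (y 0 ord_max)) *
      (fun y : 'rV[R]_n.+1 => \sum_i y 0 (lift ord_max i)) -
      (fun y : 'rV[R]_n.+1 => mu (y 0 ord_max)).
    by apply/funext => y; rewrite /F /arrow_field state_max.
  have D := is_diffB (is_diffM (compD _ _ aD) sumD) (compD _ _ muD).
  apply: (is_diff_eq D); apply/funext => v.
  rewrite /dF unlift_none /= state_max; congr (_ + _ * _ - _).
  by apply: eq_bigr => i _; rewrite state_lift.
have JE i j : J i j = dF j (delta_mx 0 i) by rewrite /J mxE dFE.
split=> //.
- move=> i j; rewrite JE /dF liftK !mxE /= (inj_eq (@lift_inj _ _)) eq_sym.
  rewrite eq_sym (negPf (neq_lift _ _)) mul0r mulr0 addr0.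
  by rewrite eq_sym; case: eqP => [->|_]; rewrite ?mulr1 ?mulr0 ?oppr0.
- move=> i; rewrite JE /dF unlift_none !mxE /= (negPf (neq_lift _ _)) !mul0r.
  rewrite mulr0 subr0 addr0 (bigD1 i)//= big1 ?addr0 => [|k ki].
    by rewrite mxE !eqxx mulr1.
  by rewrite mxE (inj_eq (@lift_inj _ _)) (negPf ki).
- move=> i; rewrite JE /dF liftK !mxE /= eq_sym (negPf (neq_lift _ _)) eqxx.
  by rewrite mulr0 add0r mul1r mulrC.
rewrite JE /dF unlift_none !mxE !eqxx /= !mul1r big1 ?mulr0 ?add0r; last first.
  by move=> i _; rewrite mxE eq_sym (negPf (neq_lift _ _)).
by rewrite mulrC.
Qed.

(** * Price, service rate and the fixed point at [qu] *)

Lemma price_decreasing_branch (R : realType) (beta qm q : R) :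
  qm < q <= 2 * qm -> price beta qm q = beta * (2 * qm - q).
Proof. by move=> /andP[qmq q2]; rewrite /price leNgt qmq /= q2. Qed.

Lemma service_lipschitz (R : realType) (mustar qc a b : R) :
    0 < mustar -> 0 < qc ->
  `|service mustar qc a - service mustar qc b| <= mustar / qc * `|a - b|.
Proof.
move=> m0 c0; wlog ab : a b / a <= b.
  move=> H; case: (leP a b) => [|/ltW] ab; first exact: H.
  by rewrite distrC [`|a - b|]distrC H.
pose s := mustar / qc; have s0 : 0 < s by rewrite divr_gt0.
(* Eliminates the division, so that the four cases are polynomial inequalities. *)
have E : mustar = s * qc by rewrite divfK // gt_eqF.
have bab : 0 <= b - a by rewrite subr_ge0.
rewrite distrC [`|a - b|]distrC (ger0_norm bab) /service -/s.
rewrite ler_norml; case: (leP a qc) => aq; case: (leP b qc) => bq;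
  rewrite ?E; apply/andP; split; nra.
Qed.

Theorem theorem4p5 (R : realType) (n : nat) (hn : (1 <= n)%N)
    (K : 'I_n -> R) (mustar qc beta qm : R)
    (hK : forall i, 0 < K i) (hmustar : 0 < mustar) (hqc : 0 < qc)
    (hbeta : 0 < beta) (hqm : 0 < qm)
    (alpha dalpha : R -> R)
    (halpha_ge0 : forall q, 0 <= q -> 0 <= alpha q)
    (halpha_C1 : C1_Rplus alpha dalpha)
    (halpha_mono : forall q1 q2, 0 <= q1 -> q1 <= q2 -> alpha q2 <= alpha q1)
    (halpha0 : 0 < alpha 0)
    (f df : 'I_n -> R -> R)
    (hf_ge0 : forall i x, 0 <= x -> 0 <= f i x)
    (hf_mono : forall i x y, 0 <= x -> x <= y -> f i x <= f i y)
    (hf_C1 : forall i, C1_Rplus (f i) (df i))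
    (hf_pos : exists i, forall x, 0 <= x -> 0 < df i x)
    (qs qu : R) :
  let p := price beta qm in
  let mu := service mustar qc in
  let g := gfun K f alpha p mu in
  forall (hq : [/\ 0 < qs, qs < qm, qm < qu & qu < 2 * qm])
    (hzeros : forall q, [/\ 0 <= q, 0 < alpha q & g q = 0] <->
                        q = qs \/ q = qu)
    (hsign_s : changes_sign g qs) (hsign_u : changes_sign g qu)
    (hdg : is_derive qu 1 g (dgfun K f alpha p mu qu))
    (hdg_gt0 : 0 < dgfun K f alpha p mu qu)
    (hdp : derive1 p qu < 0),
  let F := vfield K f alpha p mu in
  let xu := state (fun i => K i / (f i (p qu) + alpha qu)) qu in
  let DF := jacobian F xu in
  [/\ exists s : seq R, [/\ size s = n.-1, all (fun a => a < 0) s &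
        \prod_(a <- s) ('X - a%:P) %| char_poly DF],
      exists2 a : R, 0 < a & eigenvalue DF a &
      exponentially_unstable_fixed_point (@orthant R n.+1) F xu].
Proof.
move=> p mu g [qs0 qsm qmu qu2] hzeros _ _ hdg hdg_gt0 _ F xu DF.
have [_ au0 gu0] : [/\ 0 <= qu, 0 < alpha qu & g qu = 0] by apply/hzeros; right.
have qu0 : 0 < qu by rewrite (lt_trans _ qmu).
pose c i q := f i (p q) + alpha q.
have pE q : qm < q <= 2 * qm -> p q = beta * (2 * qm - q).
  exact: price_decreasing_branch.
have p_ge0 q : qm < q <= 2 * qm -> 0 <= p q.
  by move=> qq; rewrite pE // mulr_ge0 ?subr_ge0 ?(ltW hbeta) //; case/andP: qq.
have quI : qm < qu <= 2 * qm by rewrite qmu ltW.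
have pu0 : 0 < p qu by rewrite pE // mulr_gt0 // subr_gt0.
(* On [[qu, 2 * qm]] the price decreases, so [f i \o p] is nonincreasing, and so is [alpha]. *)
have c_anti i q q' : qu <= q -> q <= q' -> q' <= 2 * qm -> c i q' <= c i q.
  move=> uq qq' q'2; have q_gt : qm < q by exact: lt_le_trans uq.
  have q'_gt : qm < q' by exact: lt_le_trans qq'.
  have q2 : q <= 2 * qm by exact: le_trans q'2.
  rewrite lerD //; last by rewrite halpha_mono // (le_trans _ uq) // ltW.
  apply: hf_mono; first by rewrite p_ge0 ?q'_gt.
  by rewrite !pE ?q_gt ?q'_gt // ler_pM2l // lerD2l lerN2.
have c_gt0 i : 0 < c i qu by rewrite ltr_wpDl // hf_ge0 // ltW.
pose Rs i := K i / c i qu.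
have Rs0 i : 0 < Rs i by rewrite divr_gt0.
have KE i : K i = c i qu * Rs i by rewrite mulrC divfK // gt_eqF.
have muE : alpha qu * \sum_i Rs i = mu qu.
  have /eqP := gu0; rewrite /g /gfun subr_eq0 => /eqP ->.
  by rewrite mulrC divfK // gt_eqF.
have FE : F = arrow_field K c alpha mu by exact: vfield_arrow.
have aD : is_derive qu 1 alpha (derive1 alpha qu).
  have [+ _] := halpha_C1; move=> /(_ qu (ltW qu0)) /(has_derivative_within_interior qu0) D.
  by rewrite derive1E; apply: derivableP; case: D.
have pD : is_derive qu 1 p (- beta).
  have D : is_derive qu 1 (fun q : R => beta * (2 * qm - q)) (- beta).
    have D0 := @is_deriveZ _ _ _ (cst (2 * qm) - id) beta qu 1 _
      (is_deriveB (is_derive_cst (2 * qm) qu 1) (is_derive_id qu 1)).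
    by apply: (is_derive_eq D0); rewrite sub0r /GRing.scale /= mulrN1.
  apply: near_eq_is_derive D; near=> q; rewrite pE //; apply/andP; split.
    by near: q; exact: lt_nbhsr.
  by apply/ltW; near: q; exact: lt_nbhsl.
pose dc i := derive1 (f i \o p) qu + derive1 alpha qu.
have cD i : is_derive qu 1 (c i) (dc i).
  have fD : is_derive (p qu) 1 (f i) (df i (p qu)).
    by apply: has_derivative_within_interior => //; apply: (proj1 (hf_C1 i)); exact: ltW.
  have [D _] := is_derive1_comp fD pD.
  by apply: is_deriveD; rewrite derive1E; exact: derivableP.
have dc_le0 i : dc i <= 0.
  apply: (is_derive_le0 (cD i)); near=> q; apply: c_anti => //.
  by near: q; exact: nbhs_right_le.
(* [mu] has a kink at [qc], which may be [qu]. Differentiability at [qu] is recovered from that of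
   [g], through [mu = alpha * (\sum_i K i / c i - g)] near [qu]. *)
have muD : is_derive qu 1 mu (derive1 mu qu).
  rewrite derive1E; apply: derivableP.
  have gD : derivable g qu 1 by case: hdg.
  have aD' : derivable alpha qu 1 by case: aD.
  have SD : derivable (\sum_(i < n) (fun q => K i * (c i q)^-1)) qu 1.
    apply: derivable_sum => i; apply: (@derivableZ _ _ _ (fun q => (c i q)^-1)).
    by apply: derivableV; [rewrite gt_eqF|case: (cD i)].
  apply: near_eq_derivable (derivableM (derivableB SD gD) aD').
  have ac : {for qu, continuous alpha}.
    by apply/differentiable_continuous/derivable1_diffP.
  have a_gt0 : \forall q \near qu, 0 < alpha q.
    by have := ac [set z | 0 < z] (lt_nbhsr au0).
  near=> q; rewrite !fctE /g /gfun fct_sumE subKr divfK // gt_eqF //.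
  by near: q.
have [dF Jd Jl Jm Jmm] := arrow_field_diff K Rs cD aD muD.
have xuE : xu = state Rs qu by [].
rewrite -FE -xuE -/DF in dF Jd Jl Jm Jmm.
have w0 i : 0 <= DF ord_max (lift ord_max i) * DF (lift ord_max i) ord_max.
  rewrite Jl Jm mulr_ge0 ?(ltW au0) // oppr_ge0 mulr_le0_ge0 //.
  exact: ltW.
(* This quantity equals [alpha qu] times the derivative of [g] at [qu], using
   [alpha qu * \sum_i Rs i = mu qu]. *)
have detneg : 0 < DF ord_max ord_max +
    \sum_i DF ord_max (lift ord_max i) * DF (lift ord_max i) ord_max / c i qu.
  suff -> : DF ord_max ord_max +
    \sum_i DF ord_max (lift ord_max i) * DF (lift ord_max i) ord_max / c i qu =
    alpha qu * dgfun K f alpha p mu qu by rewrite mulr_gt0.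
  have -> : \sum_i DF ord_max (lift ord_max i) * DF (lift ord_max i) ord_max / c i qu =
     - (alpha qu * \sum_i K i * dc i / c i qu ^+ 2).
    rewrite mulr_sumr -sumrN; apply: eq_bigr => i _; rewrite Jl Jm /Rs.
    by field; rewrite gt_eqF.
  by rewrite Jmm /dgfun -muE -/dc; field; rewrite gt_eqF.
have [a [s [a0 aE sn sneg PE]]] := arrow_spectrum c_gt0 w0 Jd detneg.
have a_eig : eigenvalue DF a.
  by rewrite eigenvalue_root_char PE rootM root_XsubC eqxx.
have F0 : F xu = 0.
  rewrite FE xuE; apply/rowP; elim/ord_max_ind => [i|]; rewrite [RHS]mxE.
    by rewrite /arrow_field state_lift state_max state_lift -KE subrr.
  rewrite /arrow_field !state_max; under eq_bigr do rewrite state_lift.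
  by rewrite muE subrr.
split.
(* The spectrum consists of [a] and the [n] negative numbers in [s]; the first [n.-1] of these are
   taken. *)
- exists (take n.-1 s); split.
  + by rewrite size_takel // sn leq_pred.
  + by apply/allP => x /mem_take; exact: (allP sneg).
  + by rewrite PE -{2}(cat_take_drop n.-1 s) big_cat /= dvdp_mull // dvdp_mulr.
- by exists a.
have orth (y : 'rV[R]_n.+1) : (forall j, 0 <= y 0 j) -> orthant (xu + y).
  move=> y0; rewrite xuE; elim/ord_max_ind => [i|]; rewrite mxE ?state_lift ?state_max.
    by rewrite addr_ge0 // ltW.
  by rewrite addr_ge0 // ltW.
split=> //.
- by rewrite -[xu]addr0; apply: orth => j; rewrite mxE.
(* The eigenvector normalized to last coordinate 1: row i of the equation reads
   [alpha qu - c i qu * w_i = a * w_i], and the last row is [aE]. *)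
- pose w (j : 'I_n.+1) : R := if unlift ord_max j is Some i then
    alpha qu / (a + c i qu) else 1.
  have ac i : 0 < a + c i qu by rewrite addr_gt0.
  have w_gt0 j : 0 < w j.
    by elim/ord_max_ind: j => [i|]; rewrite /w ?liftK ?unlift_none ?divr_gt0.
  have Jw i : \sum_j DF i j * w j = a * w i.
    elim/ord_max_ind: i => [i|]; rewrite (bigD1_ord ord_max)//= {1}/w unlift_none mulr1.
      rewrite Jl (bigD1 i)//= big1 ?addr0 => [|k ki]; last first.
        by rewrite Jd eq_sym (negPf ki) mul0r.
      by rewrite Jd eqxx mulr1n /w liftK; field; rewrite gt_eqF.
    rewrite /w unlift_none mulr1 [RHS]aE; congr (_ + _); apply: eq_bigr => i _.
    by rewrite liftK Jl mulrA.
  have growth := linear_growth_near dF F0 a0 w_gt0 Jw.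
  have [Ma Ma0 aL] := C1_Rplus_lipschitz_near halpha_C1 qu0.
  have /choice[Mf MfP] i : exists M, 0 <= M /\ \forall r \near 0^'+, forall x y,
      `|x - p qu| <= r -> `|y - p qu| <= r -> `|f i x - f i y| <= M * `|x - y|.
    by have [M M0 ML] := C1_Rplus_lipschitz_near (hf_C1 i) pu0; exists M.
  have Mf0 i : 0 <= Mf i by case: (MfP i).
  (* A common Lipschitz constant for [alpha], [mu] and all [c i]; the factor [beta] is the slope of
     the price. *)
  pose M := Ma + mustar / qc + \sum_i Mf i * beta.
  have s0 : 0 < mustar / qc by rewrite divr_gt0.
  have SM0 : 0 <= \sum_i Mf i * beta.
    by rewrite sumr_ge0 // => i _; rewrite mulr_ge0 // ltW.
  have M0 : 0 <= M by rewrite !addr_ge0 // ltW.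
  have fL : \forall r \near 0^'+, forall i x y, `|x - p qu| <= beta * r ->
      `|y - p qu| <= beta * r -> `|f i x - f i y| <= Mf i * `|x - y|.
    apply: (@filter_forall _ _ (fun i r => forall x y, `|x - p qu| <= beta * r ->
      `|y - p qu| <= beta * r -> `|f i x - f i y| <= Mf i * `|x - y|)) => i.
    by have [_ /(near_right0_scale hbeta)] := MfP i.
  (* One radius for all local estimates; [qu + r <= 2 * qm] keeps the box on the decreasing branch
     of the price. *)
  have [r [r0 r2 rgrow raL rfL]] : exists r, [/\ 0 < r, qu + r <= 2 * qm,
      forall y : 'rV[R]_n.+1, (forall j, 0 <= y 0 j <= r) ->
        a / 2 * \sum_j w j * y 0 j <= \sum_j w j * F (xu + y) 0 j,
      forall x y, `|x - qu| <= r -> `|y - qu| <= r ->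
        `|alpha x - alpha y| <= Ma * `|x - y| &
      forall i x y, `|x - p qu| <= beta * r ->
      `|y - p qu| <= beta * r -> `|f i x - f i y| <= Mf i * `|x - y|].
    near (0 : R)^'+ => r; exists r; split.
    - by near: r; exact: nbhs_right_gt.
    - rewrite -lerBrDl; near: r; apply: nbhs_right_le; rewrite subr_gt0 //.
    - by near: r.
    - by near: r.
    - by near: r.
  have near_qu q : qu <= q <= qu + r -> `|q - qu| <= r.
    by move=> /andP[q1 q2]; rewrite ger0_norm ?subr_ge0 // lerBlDl.
  have in_branch q : qu <= q <= qu + r -> qm < q <= 2 * qm.
    by move=> /andP[q1 q2]; rewrite (lt_le_trans qmu) // (le_trans q2).
  have pL q q' : qu <= q <= qu + r -> qu <= q' <= qu + r -> `|p q - p q'| = beta * `|q - q'|.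
    move=> qI q'I; rewrite !pE ?in_branch // -mulrBr normrM gtr0_norm //.
    by rewrite -[in RHS]normrN; congr (_ * `|_|); ring.
  have quI' : qu <= qu <= qu + r by rewrite lexx lerDl ltW.
  have alphaL q q' : qu <= q <= qu + r -> qu <= q' <= qu + r ->
      `|alpha q - alpha q'| <= Ma * `|q - q'|.
    by move=> qI q'I; rewrite raL ?near_qu.
  have [|||||||| L [L0 FL Fpos]] := @arrow_field_box R n K c alpha mu Rs qu r M r0 M0.
  + by move=> i; exact: ltW.
  + move=> i q qI; have /andP[q1 q2] := qI.
    rewrite c_anti ?lexx ?(le_trans q2) // andbT addr_ge0 ?hf_ge0 ?p_ge0 ?in_branch //.
    by rewrite halpha_ge0 // (le_trans _ q1) // ltW.
  + move=> q /andP[q1 q2]; rewrite halpha_mono // ?(ltW qu0) // andbT.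
    by rewrite halpha_ge0 // (le_trans _ q1) // ltW.
  + move=> i q q' qI q'I; rewrite /c opprD addrACA.
    rewrite (le_trans (ler_normD _ _)) //.
    have A : `|f i (p q) - f i (p q')| <= Mf i * beta * `|q - q'|.
      rewrite -mulrA -pL // rfL // pL // ler_pM2l //; exact: near_qu.
    rewrite (le_trans (lerD A (alphaL _ _ qI q'I))) // -mulrDl ler_wpM2r //.
    have : Mf i * beta <= \sum_i Mf i * beta.
      by rewrite (bigD1 i)//= lerDl sumr_ge0 // => k _; rewrite mulr_ge0 // ltW.
    by rewrite /M; lra.
  + move=> q q' qI q'I; rewrite (le_trans (alphaL _ _ qI q'I)) // ler_wpM2r //.
    by rewrite /M; lra.
  + move=> q q' qI q'I; rewrite (le_trans (service_lipschitz _ _ _ _)) // ler_wpM2r //.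
    by rewrite /M; lra.
  + exact: KE.
  + exact: muE.
  rewrite -FE -xuE in FL Fpos.
  have a20 : 0 < a / 2 by rewrite divr_gt0.
  apply: (@cooperative_unstable R n F _ xu w r L (a / 2)) => // y yb.
  by apply: orth => j; have /andP[] := yb j.
- exists (real_complex R a) => //.
  by rewrite eigenvalue_map.
Unshelve. all: by end_near. Qed.
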